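(* Let $G$ be a permutation graph. Then its independence simplicial complex $I_G$ is homotopy equivalent to a wedge of spheres.
   Context: A chord diagram is a circle together with a finite set of chords with pairwise disjoint boundary points. It is a permutation chord diagram if the circle can be divided into two arcs $a_1$ and $a_2$ such that each chord connects a point of $a_1$ with a point of $a_2$. A permutation graph is the intersection graph of the chords of a permutation chord diagram: one vertex per chord, two vertices adjacent exactly when the chords intersect. The independence complex $I_G$ of a loopless graph $G$ is the simplicial complex whose simplices are the independent sets of vertices of $G$ (the empty set included); it is identified with its geometric realization. The independence complex of the empty graph is $\{\emptyset\}$, denoted $S^{-1}$. A ''wedge of spheres'' means a finite wedge of spheres $S^{k}$ with $k\ge 0$, formed by successive one-point identifications at arbitrarily chosen base points ($S^0$ is two points, so the result may be disconnected, and different components may each carry spheres); the empty wedge is a point, so contractible complexes count as (empty) wedges of spheres; the empty complex $S^{-1}$ is also allowed. *)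

(* Defs.v *)
From HB Require Import structures.
From mathcomp Require Import all_boot all_order all_algebra.
From mathcomp Require Import all_classical all_reals all_analysis homotopy.
Import Order.TTheory GRing.Theory Num.Theory numFieldNormedType.Exports.

Set Implicit Arguments.
Unset Strict Implicit.
Unset Printing Implicit Defensive.

Local Open Scope classical_set_scope.
Local Open Scope ring_scope.

Definition unit_circle (R : realType) : set (R * R) :=
  [set p | p.1 ^+ 2 + p.2 ^+ 2 = 1].

(* Chords are indexed by [T]; injectivity on all [#|T| * 2] endpoints says both
   that chords are nondegenerate and that their boundaries are disjoint. *)
Record chord_diagram (R : realType) (T : finType) := ChordDiagram {
  endpoint : T -> bool -> R * R ;
  endpoint_circle : forall x s, unit_circle (endpoint x s) ;
  endpoint_inj : forall x s y t,
    endpoint x s = endpoint y t -> (x, s) = (y, t) }.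

Definition segment (R : realType) (p q : R * R) : set (R * R) :=
  [set (1 - s) *: p + s *: q | s in `[0, 1]].

Definition chord (R : realType) (T : finType) (D : chord_diagram R T) (x : T) :
    set (R * R) :=
  segment (endpoint D x true) (endpoint D x false).

Definition arc (R : realType) (a b : R) : set (R * R) :=
  [set (cos t, sin t) | t in `[a, b]].

(* The circle is divided at the points of angles [a] and [b]. Using closed
   arcs is harmless: each division point lies on at most one chord. *)
Definition permutation_diagram (R : realType) (T : finType)
    (D : chord_diagram R T) : Prop :=
  exists a b : R, [/\ a < b, b < a + 2 * pi &
    forall x, exists s : bool,
      arc a b (endpoint D x s) /\ arc b (a + 2 * pi) (endpoint D x (~~ s))].

Definition is_intersection_graph (R : realType) (T : finType)
    (D : chord_diagram R T) (e : rel T) : Prop :=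
  forall x y, e x y <-> x <> y /\ chord D x `&` chord D y !=set0.

Definition permutation_graph (R : realType) (T : finType) (e : rel T) : Prop :=
  exists D : chord_diagram R T,
    permutation_diagram D /\ is_intersection_graph D e.

Definition independent (T : finType) (e : rel T) (A : {set T}) : bool :=
  [forall x in A, forall y in A, ~~ e x y].

Definition independence_complex (T : finType) (e : rel T) : {set {set T}} :=
  [set A : {set T} | independent e A]%SET.

(* Barycentric coordinates. The set of simplices [K] may contain the empty
   set, which contributes no point. *)
Definition realization (R : realType) (T : finType) (K : {set {set T}}) :
    topologicalType :=
  set_type [set t : prod_topology (fun _ : T => R) |
    [/\ forall x, 0 <= t x, \sum_x t x = 1 &
        [set x : T | t x != 0]%SET \in K]].

(* The unit sphere of [R^n], i.e. the sphere of dimension [n - 1]; it is empty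
   for [n = 0]. *)
Definition sphere (R : realType) (n : nat) : topologicalType :=
  set_type [set v : 'rV[R]_n | \sum_i v 0 i ^+ 2 = 1].

Definition wedge2_point (X Y : topologicalType) (x : X) (y : Y) (b : bool) :
    if b then X else Y :=
  if b return (if b then X else Y) then x else y.

Definition wedge2 (X Y : topologicalType) (x : X) (y : Y) : topologicalType :=
  @wedge bool (fun b => if b then X else Y) (wedge2_point x y).

Inductive wedge_of_spheres (R : realType) : topologicalType -> Prop :=
| wedge_of_spheres_Sm1 : wedge_of_spheres R (sphere R 0)
| wedge_of_spheres_point : wedge_of_spheres R (set_type [set 0 : R])
| wedge_of_spheres_attach (X : topologicalType) (x : X) (k : nat)
    (p : sphere R k.+1) :
    wedge_of_spheres R X -> wedge_of_spheres R (wedge2 x p).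

Definition homotopic (R : realType) (X Y : topologicalType) (f g : X -> Y) :
    Prop :=
  exists H : R * X -> Y,
    [/\ {within `[0, 1] `*` setT, continuous H},
        forall x, H (0, x) = f x & forall x, H (1, x) = g x].

Definition homotopy_equivalent (R : realType) (X Y : topologicalType) : Prop :=
  exists (f : X -> Y) (g : Y -> X),
    [/\ continuous f, continuous g,
        homotopic R (g \o f) id & homotopic R (f \o g) id].

(* Main.v *)
Require Import Defs.
From mathcomp Require Import all_boot all_order all_algebra.
From mathcomp Require Import all_classical all_reals all_analysis homotopy.
From mathcomp Require Import ring lra.
Import Order.TTheory GRing.Theory Num.Theory numFieldNormedType.Exports.
Set Implicit Arguments.
Unset Strict Implicit.
Unset Printing Implicit Defensive.
Local Open Scope classical_set_scope.
Local Open Scope ring_scope.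

(** Nonadjacent chords of a permutation diagram are those whose ends do not
    alternate.  Cutting the circle at the two division points turns every chord
    into a pair of angles, and two chords are nonadjacent exactly when their
    pairs are ordered oppositely ([permutation_graph_orders]); so the
    independence complex is the complex of chains of a finite set of points of
    the plane.

    Such a complex is dismantled from the left.  Let [v] be the first point and
    [w] the second one.
    - If [v] and [w] are not adjacent, every non-neighbour of [w] is a
      non-neighbour of [v], and deleting [w] does not change the homotopy type
      ([dominated_vertex]).
    - If they are adjacent, every non-neighbour of [v] other than [v] is a
      non-neighbour of [w].  The complex is then the union of the complex
      without [v] and of the complex on [v], [w] and the set [N] of
      the other non-neighbours of [v]; the intersection of the two is a cone with apex
      [w].  Contracting that cone shows the union to be the wedge of the two
      parts at [w] ([ireal_wedge2]).
    In the second case the second part is the suspension, with poles [v] and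
    [w], of the complex on [N].  To make the induction go through, the claim is
    therefore proved for complexes joined with a cross-polytope, that is, for
    iterated suspensions ([spherical_join]).  The recursion ends with a single
    point, where the complex is a cone, or with no point, where it is the
    cross-polytope alone, a sphere ([cross_polytope_sphere]).

    It remains to see that a wedge of two spaces of the homotopy type of wedges
    of spheres is again of that type, whatever the base points
    ([spherical_wedge2]).  Wedges are invariant under pointed homotopy
    equivalences, and a free homotopy equivalence between well-pointed spaces
    is a pointed one ([pointed_equiv]); this reduces the question to actual
    wedges of spheres, which are reassociated sphere by sphere
    ([wedge2_of_wedges_of_spheres]).  Well-pointedness holds at the vertices of
    a complex, where open stars contract, and at every point of a wedge of
    spheres. *)

(** * Continuous functions *)

Section ContinuousFunctions.
Context {R : realType} {X Y Z : topologicalType}.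
Implicit Types f g : X -> R.

Lemma cts_cst (y : Y) : continuous (fun _ : X => y).
Proof. exact: cst_continuous. Qed.

Lemma cts_comp (f : X -> Y) (g : Y -> Z) :
  continuous f -> continuous g -> continuous (fun x => g (f x)).
Proof. by move=> cf cg x; apply: continuous_comp; [exact: cf|exact: cg]. Qed.

Lemma cts_pair (f : X -> Y) (g : X -> Z) :
  continuous f -> continuous g -> continuous (fun x => (f x, g x)).
Proof. by move=> cf cg x; apply: cvg_pair; [exact: cf|exact: cg]. Qed.

Lemma cts_fst (f : X -> Y * Z) : continuous f -> continuous (fun x => (f x).1).
Proof. by move=> cf x; apply: (cvg_comp _ _ (cf x)); exact: cvg_fst. Qed.

Lemma cts_snd (f : X -> Y * Z) : continuous f -> continuous (fun x => (f x).2).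
Proof. by move=> cf x; apply: (cvg_comp _ _ (cf x)); exact: cvg_snd. Qed.

Lemma cts_add f g :
  continuous f -> continuous g -> continuous (fun x => f x + g x).
Proof. by move=> cf cg x; apply: (cvgD (cf x) (cg x)). Qed.

Lemma cts_opp f : continuous f -> continuous (fun x => - f x).
Proof. by move=> cf x; apply: (cvgN (cf x)). Qed.

Lemma cts_mul f g :
  continuous f -> continuous g -> continuous (fun x => f x * g x).
Proof. by move=> cf cg x; apply: (cvgM (cf x) (cg x)). Qed.

Lemma cts_inv f :
  (forall x, f x != 0) -> continuous f -> continuous (fun x => (f x)^-1).
Proof. by move=> f0 cf x; apply: (cvgV (f0 x) (cf x)). Qed.

Lemma cts_norm f : continuous f -> continuous (fun x => `|f x|).
Proof. by move=> cf x; apply: (cvg_norm (cf x)). Qed.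

Lemma cts_max f g :
  continuous f -> continuous g -> continuous (fun x => Num.max (f x) (g x)).
Proof. by move=> cf cg x; apply: continuous_max; [exact: cf|exact: cg]. Qed.

Lemma cts_min f g :
  continuous f -> continuous g -> continuous (fun x => Num.min (f x) (g x)).
Proof. by move=> cf cg x; apply: continuous_min; [exact: cf|exact: cg]. Qed.

Lemma cts_sum (I : Type) (r : seq I) (P : pred I) (F : I -> X -> R) :
  (forall i, continuous (F i)) ->
  continuous (fun x => \sum_(i <- r | P i) F i x).
Proof.
by move=> cF; apply: continuous_big => //; exact: add_continuous.
Qed.

Lemma cts_if (b : bool) (f g : X -> Y) :
  continuous f -> continuous g -> continuous (fun x => if b then f x else g x).
Proof. by case: b. Qed.

End ContinuousFunctions.

Lemma cts_id (X : topologicalType) : continuous (fun x : X => x).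
Proof. by move=> x; exact: cvg_id. Qed.

Ltac cts := repeat first [ assumption |
  lazymatch goal with
  | |- forall x, continuous_at _ ?F =>
    lazymatch F with
    | (fun _ => ?c) => apply: cts_cst
    | (fun x => x) => apply: cts_id
    | (fun x => (_, _)) => apply: cts_pair
    | @fst _ _ => exact: (cts_fst (@cts_id _))
    | @snd _ _ => exact: (cts_snd (@cts_id _))
    | (fun x => fst _) => apply: cts_fst
    | (fun x => snd _) => apply: cts_snd
    | (fun x => Algebra.add _ _) => apply: cts_add
    | (fun x => Algebra.opp _) => apply: cts_opp
    | (fun x => GRing.mul _ _) => apply: cts_mul
    | (fun x => Order.max _ _) => apply: cts_max
    | (fun x => Order.min _ _) => apply: cts_min
    | (fun x => Num.norm _) => apply: cts_norm
    | (fun x => if _ then _ else _) => apply: cts_if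
    end
  end].

Lemma closed_level (R : realType) (X : topologicalType) (f : X -> R) :
  continuous f -> closed [set x | 0 <= f x].
Proof.
move=> cf; rewrite (_ : [set _ | _] = f @^-1` [set y | 0 <= y]) //.
by apply: closed_comp => [x _|]; [exact: cf|exact: closed_ge].
Qed.

Lemma closed_zero (R : realType) (X : topologicalType) (f : X -> R) :
  continuous f -> closed [set x | f x = 0].
Proof.
move=> cf; rewrite (_ : [set _ | _] = f @^-1` [set 0]) //.
by apply: closed_comp => [x _|]; [exact: cf|exact: closed_eq].
Qed.

Lemma cts_paste (X Y : topologicalType) (A B : set X) (f g h : X -> Y) :
  closed A -> closed B -> A `|` B = setT ->
  continuous f -> continuous g ->
  (forall x, A x -> h x = f x) -> (forall x, B x -> h x = g x) -> continuous h.
Proof.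
move=> clA clB AB cf cg hf hg.
apply/continuous_subspace_setT; rewrite -AB; apply: withinU_continuous => //.
- apply: (@subspace_eq_continuous _ A _ f) => [x /set_mem Ax|].
    by symmetry; exact: hf.
  exact: continuous_subspaceT.
- apply: (@subspace_eq_continuous _ B _ g) => [x /set_mem Bx|].
    by symmetry; exact: hg.
  exact: continuous_subspaceT.
Qed.

Lemma cts_ifge (R : realType) (X Y : topologicalType) (u : X -> R)
    (f g : X -> Y) :
  continuous u -> continuous f -> continuous g ->
  (forall x, u x = 0 -> f x = g x) ->
  continuous (fun x => if 0 <= u x then f x else g x).
Proof.
move=> cu cf cg fg.
apply: (@cts_paste _ _ [set x | 0 <= u x] [set x | 0 <= - u x] f g) => //.
- exact: closed_level.
- by apply: closed_level; cts.
- rewrite -subTset => x _ /=; rewrite oppr_ge0; case: (lerP 0 (u x)) => h.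
    by left.
  by right; apply: ltW.
- by move=> x /= ->.
- move=> x /=; rewrite oppr_ge0 => u0; case: ifPn => // u1.
  by apply: fg; apply/eqP; rewrite eq_le u0.
Qed.

(** * Homotopies relative to a set *)

Section Homotopy.
Context {R : realType}.

Definition clamp (t : R) : R := Num.max 0 (Num.min 1 t).

Lemma clamp_bounds t : 0 <= clamp t <= 1.
Proof. by rewrite /clamp le_max lexx ge_max ler01 ge_min lexx. Qed.

Lemma clamp0 : clamp 0 = 0.
Proof. by rewrite /clamp min_r ?ler01 // maxxx. Qed.

Lemma clamp1 : clamp 1 = 1.
Proof. by rewrite /clamp minxx max_r. Qed.

Lemma cts_clamp (X : topologicalType) (f : X -> R) :
  continuous f -> continuous (fun x => clamp (f x)).
Proof. by move=> cf; rewrite /clamp; cts. Qed.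

(** The time parameter ranges over the whole line, which spares the boundary
    cases at [0] and [1] when homotopies are composed or reparametrized;
    [clamp] extends a homotopy given on the unit interval. *)
Definition homotopic_rel (X Y : topologicalType) (A : set X) (f g : X -> Y) :=
  exists H : R * X -> Y,
    [/\ continuous H, forall x, H (0, x) = f x, forall x, H (1, x) = g x &
        forall t x, A x -> H (t, x) = f x].

Lemma homotopic_rel_refl (X Y : topologicalType) (A : set X) (f : X -> Y) :
  continuous f -> homotopic_rel A f f.
Proof.
by move=> cf; exists (fun p => f p.2); split => //; apply: cts_comp => //; cts.
Qed.

Lemma homotopic_rel_sym (X Y : topologicalType) (A : set X) (f g : X -> Y) :
  homotopic_rel A f g -> homotopic_rel A g f.
Proof.
move=> [H [cH H0 H1 HA]]; exists (fun p => H (1 - p.1, p.2)); split => //=.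
- by apply: (cts_comp (g := H)) => //; cts.
- by move=> x; rewrite subr0 H1.
- by move=> x; rewrite subrr H0.
- by move=> t x Ax; rewrite HA // -H1 HA.
Qed.

Lemma homotopic_rel_trans (X Y : topologicalType) (A : set X)
    (f g h : X -> Y) :
  homotopic_rel A f g -> homotopic_rel A g h -> homotopic_rel A f h.
Proof.
move=> [H [cH H0 H1 HA]] [K [cK K0 K1 KA]].
exists (fun p => if 0 <= 2 * p.1 - 1 then K (2 * p.1 - 1, p.2)
                 else H (2 * p.1, p.2)); split => //=.
- apply: cts_ifge.
  + by cts.
  + by apply: (cts_comp (g := K)) => //; cts.
  + by apply: (cts_comp (g := H)) => //; cts.
  + move=> -[t x] /= t0; rewrite t0 K0 (_ : 2 * t = 1) ?H1 //.
    by apply/eqP; rewrite -subr_eq0 t0.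
- by move=> x; rewrite mulr0 sub0r oppr_ge0 leNgt ltr01 /= H0.
- by move=> x; rewrite mulr1 -[2]/(1 + 1) addrK ler01 K1.
- by move=> t x Ax; rewrite HA // KA // -H1 HA // if_same.
Qed.

Lemma homotopic_rel_comp (X Y Z : topologicalType) (A : set X)
    (f g : X -> Y) (k : Y -> Z) :
  continuous k -> homotopic_rel A f g ->
  homotopic_rel A (k \o f) (k \o g).
Proof.
move=> ck [H [cH H0 H1 HA]]; exists (k \o H); split => /=.
- exact: cts_comp.
- by move=> x; rewrite H0.
- by move=> x; rewrite H1.
- by move=> t x Ax; rewrite HA.
Qed.

Lemma homotopic_rel_precomp (W X Y : topologicalType) (B : set W) (A : set X)
    (f g : X -> Y) (k : W -> X) :
  continuous k -> (forall w, B w -> A (k w)) -> homotopic_rel A f g ->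
  homotopic_rel B (f \o k) (g \o k).
Proof.
move=> ck BA [H [cH H0 H1 HA]]; exists (fun p => H (p.1, k p.2)); split => /=.
- apply: (cts_comp (g := H)) => //; apply: cts_pair; first by cts.
  by apply: cts_comp => //; cts.
- by move=> x; rewrite H0.
- by move=> x; rewrite H1.
- by move=> t x Bx; rewrite HA //; apply: BA.
Qed.

Lemma homotopic_rel_sub (X Y : topologicalType) (A B : set X) (f g : X -> Y) :
  B `<=` A -> homotopic_rel A f g -> homotopic_rel B f g.
Proof.
by move=> BA [H [cH H0 H1 HA]]; exists H; split => // t x /BA; exact: HA.
Qed.

Lemma homotopic_rel_ext (X Y : topologicalType) (A : set X)
    (f g f' g' : X -> Y) :
  f =1 f' -> g =1 g' -> homotopic_rel A f g -> homotopic_rel A f' g'.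
Proof. by move=> /funext <- /funext <-. Qed.

(** With [A] and [B] empty this is a free homotopy equivalence, with [A] and
    [B] singletons a pointed one. *)
Definition equiv_rel (X Y : topologicalType) (A : set X) (B : set Y)
    (f : X -> Y) :=
  [/\ continuous f, forall x, A x -> B (f x) &
   exists g : Y -> X, [/\ continuous g, forall y, B y -> A (g y),
    homotopic_rel A (g \o f) id & homotopic_rel B (f \o g) id]].

Lemma equiv_rel_id (X : topologicalType) (A : set X) : equiv_rel A A id.
Proof.
have c : continuous (@id X) by exact: cts_id.
by split => //; exists id; split => //; exact: homotopic_rel_refl.
Qed.

Lemma equiv_rel_comp (X Y Z : topologicalType) (A : set X) (B : set Y)
    (C : set Z) (f : X -> Y) (f' : Y -> Z) :
  equiv_rel A B f -> equiv_rel B C f' -> equiv_rel A C (f' \o f).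
Proof.
move=> [cf AB [g [cg BA gf fg]]] [cf' BC [g' [cg' CB gf' fg']]].
split; first exact: cts_comp.
  by move=> x /AB /BC.
exists (g \o g'); split; first exact: cts_comp.
- by move=> z /CB /BA.
- apply: homotopic_rel_trans gf.
  apply: (homotopic_rel_ext (f := g \o (g' \o f') \o f)
    (g := g \o id \o f)) => //.
  exact: (homotopic_rel_precomp cf AB (homotopic_rel_comp cg gf')).
- apply: homotopic_rel_trans fg'.
  apply: (homotopic_rel_ext (f := f' \o (f \o g) \o g')
    (g := f' \o id \o g')) => //.
  exact: (homotopic_rel_precomp cg' CB (homotopic_rel_comp cf' fg)).
Qed.

Definition equivalent_rel (X Y : topologicalType) (A : set X) (B : set Y) :=
  exists f : X -> Y, equiv_rel A B f.

Lemma equivalent_rel_sym (X Y : topologicalType) (A : set X) (B : set Y) :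
  equivalent_rel A B -> equivalent_rel B A.
Proof.
move=> [f [cf AB [g [cg BA gf fg]]]].
by exists g; split => //; exists f; split.
Qed.

Lemma equivalent_rel_trans (X Y Z : topologicalType) (A : set X) (B : set Y)
    (C : set Z) :
  equivalent_rel A B -> equivalent_rel B C -> equivalent_rel A C.
Proof. by move=> [f hf] [g hg]; exists (g \o f); exact: equiv_rel_comp hf hg. Qed.

Definition heq (X Y : topologicalType) :=
  equivalent_rel (@set0 X) (@set0 Y).

Lemma homotopic_of_rel (X Y : topologicalType) (A : set X) (f g : X -> Y) :
  homotopic_rel A f g -> homotopic R f g.
Proof.
by move=> [H [cH H0 H1 _]]; exists H; split => //; exact: continuous_subspaceT.
Qed.

Lemma homotopy_equivalent_of_rel (X Y : topologicalType) (A : set X)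
    (B : set Y) :
  equivalent_rel A B -> homotopy_equivalent R X Y.
Proof.
move=> [f [cf _ [g [cg _ gf fg]]]].
by exists f, g; split => //; apply: homotopic_of_rel; eassumption.
Qed.

End Homotopy.
Arguments heq R X Y : clear implicits.
(** * Wedges of two spaces *)

Section Wedge2.
Context {X Y : topologicalType} {x0 : X} {y0 : Y}.

Definition winl (x : X) : wedge2 x0 y0 :=
  @wedge_lift bool _ (wedge2_point x0 y0) true x.
Definition winr (y : Y) : wedge2 x0 y0 :=
  @wedge_lift bool _ (wedge2_point x0 y0) false y.

Lemma winl_continuous : continuous winl.
Proof. exact: (@wedge_lift_continuous bool _ (wedge2_point x0 y0) true). Qed.

Lemma winr_continuous : continuous winr.
Proof. exact: (@wedge_lift_continuous bool _ (wedge2_point x0 y0) false). Qed.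

Lemma winl_winr : winl x0 = winr y0.
Proof. exact: (@wedge_liftE bool _ (wedge2_point x0 y0) false y0 true x0). Qed.

Lemma wedge2P (w : wedge2 x0 y0) :
  (exists x, w = winl x) \/ (exists y, w = winr y).
Proof.
have : [set: wedge2 x0 y0] w by [].
by rewrite /wedge2 -wedgeTE => -[[] _ [z _ <-]]; [left|right]; exists z.
Qed.

Lemma open_wedge2 (U : set (wedge2 x0 y0)) :
  open (winl @^-1` U) -> open (winr @^-1` U) -> open U.
Proof.
by move=> oX oY; apply/(@wedge_openP bool _ (wedge2_point x0 y0)) => -[].
Qed.

Section Elim.
Context {Z : Type} (f : X -> Z) (g : Y -> Z).

Definition wbranch (b : bool) : (if b then X else Y) -> Z :=
  if b return (if b then X else Y) -> Z then f else g.

Definition welim : wedge2 x0 y0 -> Z :=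
  @wedge_fun bool _ (wedge2_point x0 y0) Z wbranch.

Hypothesis fg : f x0 = g y0.

Let wbranchE i j : wbranch (wedge2_point x0 y0 i) = wbranch (wedge2_point x0 y0 j).
Proof. by case: i; case: j => //=. Qed.

Lemma welim_l x : welim (winl x) = f x.
Proof. exact: (@wedge_lift_funE bool _ (wedge2_point x0 y0) Z wbranch true x). Qed.

Lemma welim_r y : welim (winr y) = g y.
Proof. exact: (@wedge_lift_funE bool _ (wedge2_point x0 y0) Z wbranch false y). Qed.

End Elim.

Lemma winl_inj : injective winl.
Proof.
move=> x x' e.
have E z : welim id (fun _ => x0) (winl z) = z by apply: (welim_l (f := id)).
by rewrite -(E x) e E.
Qed.

Lemma winr_inj : injective winr.
Proof.
move=> y y' e.
have E z : welim (fun _ => y0) id (winr z) = z by apply: (welim_r (g := id)).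
by rewrite -(E y) e E.
Qed.

Lemma winl_eq_winr x y : winl x = winr y -> x = x0 /\ y = y0.
Proof.
move=> e; split.
  have E z : welim id (fun _ => x0) (winl z) = z by apply: (welim_l (f := id)).
  by rewrite -(E x) e (welim_r (f := id)).
have E z : welim (fun _ => y0) id (winr z) = z by apply: (welim_r (g := id)).
by rewrite -(E y) -e (welim_l (g := id)).
Qed.

(** A product with a quotient space need not be a quotient space, but here
    neighbourhoods are explicit: a neighbourhood of the base point is the union
    of one in each summand, and an open set of a summand that avoids the base
    point is open in the wedge. *)
Lemma cts_wedge2_joint (P Z : topologicalType) (h : P * wedge2 x0 y0 -> Z) :
  continuous (fun q : P * X => h (q.1, winl q.2)) ->
  continuous (fun q : P * Y => h (q.1, winr q.2)) ->
  continuous h.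
Proof.
move=> hX hY -[p w] U /=; rewrite nbhs_simpl /= => Uh.
have opennbhs (T : topologicalType) (t : T) (V : set (P * T)) :
    nbhs (p, t) V -> exists A B, [/\ nbhs p A, open B, B t &
      forall a b, A a -> B b -> V (a, b)].
  move=> [[A B] /= [nA nB] AB].
  move: nB; rewrite nbhsE => -[B' [oB' B't] B'B].
  exists A, B'; split => // a b Aa B'b.
  by apply: AB; split => //=; exact: B'B.
have base : U° (h (p, winl x0)) -> exists A BX BY,
    [/\ nbhs p A, open BX, open BY, BX x0 & BY y0] /\
    [/\ forall a b, A a -> BX b -> U (h (a, winl b)) &
        forall a b, A a -> BY b -> U (h (a, winr b))].
  move=> Uh0.
  have /opennbhs [A [B [nA oB Bx AB]]] := hX (p, x0) _ Uh0.
  have Uh0' : U° (h (p, winr y0)) by rewrite -winl_winr.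
  have /opennbhs [A' [B' [nA' oB' By AB']]] := hY (p, y0) _ Uh0'.
  exists (A `&` A'), B, B'; split; split => //.
  - exact: filterI.
  - by move=> a b [Aa _] Bb; exact: AB.
  - by move=> a b [_ Aa] Bb; exact: AB'.
have fin (A : set P) (BX : set X) (BY : set Y) :
    nbhs p A -> open BX -> open BY -> (BX x0 <-> BY y0) ->
    (exists2 x, BX x & w = winl x) \/ (exists2 y, BY y & w = winr y) ->
    (forall a b, A a -> BX b -> U (h (a, winl b))) ->
    (forall a b, A a -> BY b -> U (h (a, winr b))) ->
    nbhs (p, w) (h @^-1` U).
  move=> nA oX oY XY inw UX UY.
  pose W := (winl @` BX) `|` (winr @` BY).
  exists (A, W) => /=; last first.
    by move=> [a b] /= [Aa [[x Bx <-]|[y By <-]]]; [exact: UX|exact: UY].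
  split => //; apply: open_nbhs_nbhs; split; last first.
    case: inw => -[z Bz ->]; first by left; exists z.
    by right; exists z.
  apply: open_wedge2.
    rewrite (_ : _ @^-1` _ = BX) //; apply/seteqP; split => x; last first.
      by move=> Bx; left; exists x.
    move=> [[x' Bx' /winl_inj <- //]|[y By]].
    by move=> /esym /winl_eq_winr [-> E]; apply/XY; rewrite -E.
  rewrite (_ : _ @^-1` _ = BY) //; apply/seteqP; split => y; last first.
    by move=> By; right; exists y.
  move=> [[x Bx]|[y' By' /winr_inj <- //]].
  by move=> /winl_eq_winr [E ->]; apply/XY; rewrite -E.
have Uo : nbhs (h (p, w)) U° by exact: nbhs_interior.
have UoU : U° `<=` U by exact: interior_subset.
have [[x wx]|[y wy]] := wedge2P w.
- rewrite wx in Uo Uh.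
  have /opennbhs [A [B [nA oB Bx AB]]] := hX (p, x) _ Uo.
  have [B0|B0] := pselect (B x0).
    have := AB p x0 (nbhs_singleton nA) B0 => /= U0.
    have [A' [BX [BY [[nA' oX oY X0 Y0] [UX UY]]]]] := base U0.
    apply: (fin (A `&` A') (B `|` BX) BY) => //.
    + exact: filterI.
    + exact: openU.
    + by split => // _; left.
    + by left; exists x => //; left.
    + by move=> a b [Aa A'a] [Bb|Xb]; [apply/UoU/AB|exact: UX].
    + by move=> a b [Aa A'a] Yb; exact: UY.
  apply: (fin A B set0) => //; first exact: open0.
  + by left; exists x.
  + by move=> a b Aa Bb; apply/UoU/AB.
- rewrite wy in Uo Uh.
  have /opennbhs [A [B [nA oB By AB]]] := hY (p, y) _ Uo.
  have [B0|B0] := pselect (B y0).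
    have := AB p y0 (nbhs_singleton nA) B0 => /=; rewrite -winl_winr => U0.
    have [A' [BX [BY [[nA' oX oY X0 Y0] [UX UY]]]]] := base U0.
    apply: (fin (A `&` A') BX (B `|` BY)) => //.
    + exact: filterI.
    + exact: openU.
    + by split => // _; right.
    + by right; exists y => //; left.
    + by move=> a b [Aa A'a] Xb; exact: UX.
    + by move=> a b [Aa A'a] [Bb|Yb]; [apply/UoU/AB|exact: UY].
  apply: (fin A set0 B) => //; first exact: open0.
  + by right; exists y.
  + by move=> a b Aa Bb; apply/UoU/AB.
Qed.

Lemma cts_wedge2 (Z : topologicalType) (h : wedge2 x0 y0 -> Z) :
  continuous (h \o winl) -> continuous (h \o winr) -> continuous h.
Proof.
move=> hX hY; apply/continuousP => U oU; apply: open_wedge2.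
  by move/continuousP: hX; apply.
by move/continuousP: hY; apply.
Qed.

Lemma cts_welim (Z : topologicalType) (f : X -> Z) (g : Y -> Z) :
  f x0 = g y0 -> continuous f -> continuous g -> continuous (welim f g).
Proof.
move=> fg cf cg; apply: cts_wedge2.
  by rewrite (_ : _ \o _ = f) //; apply/funext => x; exact: welim_l.
by rewrite (_ : _ \o _ = g) //; apply/funext => y; exact: welim_r.
Qed.

Lemma wedge2_ext (Z : Type) (h k : wedge2 x0 y0 -> Z) :
  (forall x, h (winl x) = k (winl x)) -> (forall y, h (winr y) = k (winr y)) ->
  h =1 k.
Proof. by move=> hl hr w; have [[x ->]|[y ->]] := wedge2P w. Qed.

Lemma homotopic_rel_wedge2 (R : realType) (Z : topologicalType)
    (A : set (wedge2 x0 y0)) (h k : wedge2 x0 y0 -> Z)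
    (HX : R * X -> Z) (HY : R * Y -> Z) :
  continuous HX -> continuous HY -> (forall t, HX (t, x0) = HY (t, y0)) ->
  (forall x, HX (0, x) = h (winl x)) -> (forall y, HY (0, y) = h (winr y)) ->
  (forall x, HX (1, x) = k (winl x)) -> (forall y, HY (1, y) = k (winr y)) ->
  (forall t x, A (winl x) -> HX (t, x) = h (winl x)) ->
  (forall t y, A (winr y) -> HY (t, y) = h (winr y)) ->
  homotopic_rel (R := R) A h k.
Proof.
move=> cX cY XY X0 Y0 X1 Y1 XA YA.
pose H (q : R * wedge2 x0 y0) :=
  welim (fun x => HX (q.1, x)) (fun y => HY (q.1, y)) q.2.
have Hl t x : H (t, winl x) = HX (t, x).
  by rewrite /H /= (welim_l (f := fun x => HX (t, x))).
have Hr t y : H (t, winr y) = HY (t, y).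
  by rewrite /H /= (welim_r (g := fun x => HY (t, x))).
exists H; split.
- apply: cts_wedge2_joint.
    by rewrite (_ : (fun _ => _) = HX) //; apply/funext => -[t x]; rewrite Hl.
  by rewrite (_ : (fun _ => _) = HY) //; apply/funext => -[t x]; rewrite Hr.
- by apply: wedge2_ext => z; rewrite ?Hl ?Hr.
- by apply: wedge2_ext => z; rewrite ?Hl ?Hr.
- by move=> t w; have [[x ->]|[y ->]] := wedge2P w; rewrite ?Hl ?Hr; auto.
Qed.

End Wedge2.
(** * Well-pointed spaces *)

Section WellPointed.
Context {R : realType}.

(** [D] deforms the identity, keeping [x] fixed and moving nothing outside [N],
    until the neighbourhood [0 <= u] of [x] is crushed to [x].  The function [u]
    also measures how far inside that neighbourhood a point lies, reaching [1]
    at [x] only: it is the parameter of the paths along which maps are dragged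
    below, and it makes [x] a closed point. *)
Definition well_pointed_in (X : topologicalType) (x : X) (N : set X) :=
  exists (D : R * X -> X) (u : X -> R),
    [/\ continuous D, continuous u, forall z, D (0, z) = z &
        forall t, D (t, x) = x] /\
    [/\ u x = 1, forall z, u z = 1 -> z = x, forall z, 0 <= u z -> D (1, z) = x
      & forall z, ~ N z -> u z < 0 /\ forall t, D (t, z) = z].

Definition well_pointed (X : topologicalType) (x : X) :=
  well_pointed_in x setT.

(** Contractions with small support are what passes to wedges: contracting
    around a point of one summand must leave the gluing point alone. *)
Definition locally_well_pointed (X : topologicalType) :=
  forall (x : X) (N : set X), nbhs x N -> well_pointed_in x N.

Lemma locally_well_pointedW (X : topologicalType) (x : X) :
  locally_well_pointed X -> well_pointed x.
Proof. by move=> wX; apply: wX; exact: filterT. Qed.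

Lemma closed_point (X : topologicalType) (x : X) :
  well_pointed x -> closed [set x].
Proof.
move=> [D [u [[_ cu _ _] [ux u1 _ _]]]].
rewrite (_ : [set x] = [set z | u z - 1 = 0]).
  by apply: closed_zero; cts.
apply/seteqP; split => z /=; first by move=> ->; rewrite ux subrr.
by move=> /eqP; rewrite subr_eq0 => /eqP /u1.
Qed.

(** Dragging a map along a path: [drag D u f g] is [f] precomposed with the
    retraction [D 1] outside a neighbourhood of the base point, on which it
    runs through the path [g] starting at the image of the base point. *)
Definition drag (X Y : topologicalType) (D : R * X -> X) (u : X -> R)
    (f : X -> Y) (g : R -> Y) (z : X) : Y :=
  if 0 <= u z then g (u z) else f (D (1, z)).

Section Drag.
Context {X Y : topologicalType} {x : X} {D : R * X -> X} {u : X -> R}.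
Hypotheses (cD : continuous D) (cu : continuous u)
  (D0 : forall z, D (0, z) = z) (Dx : forall t, D (t, x) = x)
  (ux : u x = 1) (Du : forall z, 0 <= u z -> D (1, z) = x).

Lemma drag_base (f : X -> Y) (g : R -> Y) : drag D u f g x = g 1.
Proof. by rewrite /drag ux ler01. Qed.

Lemma cts_drag (P : topologicalType) (F : P * X -> Y) (G : P * R -> Y) :
  continuous F -> continuous G -> (forall p, F (p, x) = G (p, 0)) ->
  continuous (fun q => drag D u (fun z => F (q.1, z)) (fun s => G (q.1, s)) q.2).
Proof.
move=> cF cG FG; apply: cts_ifge.
- by apply: (cts_comp (f := snd)) => //; cts.
- apply: (cts_comp (g := G)) => //; apply: cts_pair; first by cts.
  by apply: (cts_comp (f := snd)) => //; cts.
- apply: (cts_comp (g := F)) => //; apply: cts_pair; first by cts.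
  by apply: (cts_comp (g := D)) => //; cts.
- by move=> -[p z] /= u0; rewrite Du u0.
Qed.

Lemma homotopic_drag (F : R * X -> Y) (G : R * R -> Y) :
  continuous F -> continuous G -> (forall t, F (t, x) = G (t, 0)) ->
  (forall t, G (t, 1) = G (0, 1)) ->
  homotopic_rel (R := R) [set x]
    (drag D u (fun z => F (0, z)) (fun s => G (0, s)))
    (drag D u (fun z => F (1, z)) (fun s => G (1, s))).
Proof.
move=> cF cG FG G1.
exists (fun q => drag D u (fun z => F (q.1, z)) (fun s => G (q.1, s)) q.2).
split => //; first exact: cts_drag.
by move=> t _ ->; rewrite !drag_base.
Qed.

Lemma drag_cst (f : X -> Y) : drag D u f (fun=> f x) =1 f \o D \o (pair 1).
Proof. by move=> z; rewrite /drag /=; case: ifP => // /Du ->. Qed.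

Lemma homotopic_retract (A : set X) (f : X -> Y) : A `<=` [set x] ->
  continuous f -> homotopic_rel (R := R) A f (f \o D \o (pair 1)).
Proof.
move=> Ax cf; exists (f \o D); split => //=; first exact: cts_comp.
  by move=> z; rewrite D0.
by move=> t _ /Ax ->; rewrite Dx.
Qed.

Lemma drag_free (f : X -> Y) (g : R -> Y) :
  continuous f -> continuous g -> f x = g 0 ->
  homotopic_rel (R := R) set0 f (drag D u f g).
Proof.
move=> cf cg fg; apply: (homotopic_rel_trans (homotopic_retract _ cf)) => //.
exists (fun q => drag D u f (fun s => g (q.1 * s)) q.2); split => //.
- apply: (cts_drag (F := fun q : R * X => f q.2) (G := fun p : R * R => g (p.1 * p.2))).
  + by apply: cts_comp => //; cts.
  + by apply: (cts_comp (g := g)) => //; cts.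
  + by move=> p; rewrite mulr0.
- move=> z; rewrite -drag_cst /drag fg /=.
  by case: ifP => //; rewrite mul0r.
- by move=> z; rewrite /drag mul1r.
Qed.

End Drag.

(** Under a free inverse [g] the base point
    ends up at [g y], and the homotopy [H] from [g \o f] to the identity traces
    a path [c] from there back to [x]; dragging [g] along [c] gives a pointed
    map.  At every stage of the homotopies below, the part of [c] that remains
    to be run is dragged, so that [x] stays fixed. *)
Lemma pointed_left_inverse (X Y : topologicalType) (x : X) (y : Y)
    (f : X -> Y) :
  well_pointed x -> well_pointed y -> f x = y ->
  equiv_rel (R := R) set0 set0 f ->
  exists g : Y -> X, [/\ equiv_rel (R := R) set0 set0 g, g y = x &
    homotopic_rel (R := R) [set x] (g \o f) id].
Proof.
move=> [D [u [[cD cu D0 Dx] [ux u1 Du _]]]].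
move=> [E [v [[cE cv E0 Ey] [vy v1 Ev _]]]] fx [cf _ [g [cg _ gf fg]]].
have [H [cH H0 H1 _]] := gf.
pose c s := H (s, x).
have cc : continuous c by apply: (cts_comp (g := H)) => //; cts.
have c0 : c 0 = g y by rewrite /c H0 /= fx.
pose g' := drag E v g c.
have cg' : continuous g'.
  apply: (cts_comp (f := fun z => (0 : R, z))
    (g := fun q : R * Y => drag E v g c q.2)); first by cts.
  apply: (cts_drag (x := y) cE cv Ev (F := g \o snd) (G := c \o snd)) => //.
  - by apply: (cts_comp (f := snd)) => //; cts.
  - by apply: (cts_comp (f := snd)) => //; cts.
have gg' : homotopic_rel (R := R) set0 g g'.
  exact: (drag_free cE cv E0 Ey Ev cg cc (esym c0)).
have gf' : homotopic_rel (R := R) set0 (g' \o f) id.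
  apply: homotopic_rel_trans gf.
  apply: (homotopic_rel_precomp (A := set0)) => //.
  exact: homotopic_rel_sym.
have fg' : homotopic_rel (R := R) set0 (f \o g') id.
  apply: homotopic_rel_trans fg.
  apply: homotopic_rel_comp => //.
  exact: homotopic_rel_sym.
exists g'; split.
- by split => //; exists f; split.
- by rewrite /g' (drag_base vy) /c H1.
(* first, make the map drag a constant path *)
apply: (homotopic_rel_trans
  (homotopic_retract (x := x) cD D0 Dx _ (cts_comp cf cg'))) => //.
have g'fx : g' (f x) = x by rewrite fx /g' (drag_base vy) /c H1.
apply: (homotopic_rel_ext (f := drag D u (g' \o f) (fun=> x)) (g := id)) => //.
  by move=> z; rewrite -[x in fun=> x]g'fx (drag_cst Du (g' \o f)).
(* then shorten the path dragged by g' while lengthening the outer one *)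
apply: (homotopic_rel_trans (g := drag D u (g \o E \o pair 1 \o f) c)).
  apply: homotopic_rel_sym.
  apply: (homotopic_rel_ext
    (f := drag D u (fun z => drag E v g (fun s => c (0 * s)) (f z))
                   (fun s => c (0 + s * (1 - 0))))
    (g := drag D u (fun z => drag E v g (fun s => c (1 * s)) (f z))
                   (fun s => c (1 + s * (1 - 1))))).
  - move=> z; rewrite /drag; case: ifP => _.
      by rewrite add0r subr0 mulr1.
    case: ifP => //= /Ev ->; by rewrite mul0r c0.
  - move=> z; rewrite /drag; case: ifP => _.
      by rewrite subrr mulr0 addr0 /c H1.
    by rewrite /g' /drag /= mul1r.
  apply: (homotopic_drag cD cu ux Du
    (F := fun q => drag E v g (fun s => c (q.1 * s)) (f q.2))
    (G := fun q => c (q.1 + q.2 * (1 - q.1)))).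
  - apply: (cts_comp (f := fun q : R * X => (q.1, f q.2))
      (g := fun q => drag E v g (fun s => c (q.1 * s)) q.2)).
      by apply: cts_pair; [cts|apply: cts_comp => //; cts].
    apply: (cts_drag (x := y) cE cv Ev (F := fun q : R * Y => g q.2)
      (G := fun q : R * R => c (q.1 * q.2))).
    + by apply: (cts_comp (f := snd)) => //; cts.
    + by apply: (cts_comp (g := c)) => //; cts.
    + by move=> p; rewrite mulr0 c0.
  - by apply: (cts_comp (g := c)) => //; cts.
  - by move=> t; rewrite fx (drag_base vy) mulr1 mul0r addr0.
  - by move=> t; rewrite !mul1r add0r subr0 addrC subrK.
(* undo the retraction of Y *)
apply: (homotopic_rel_trans (g := drag D u (g \o f) c)).
  apply: homotopic_rel_sym.
  apply: (homotopic_rel_ext (f := drag D u (fun z => g (E (0, f z))) c)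
    (g := drag D u (fun z => g (E (1, f z))) c)) => //.
    by move=> z; rewrite /drag E0.
  apply: (homotopic_drag cD cu ux Du
    (F := fun q => g (E (q.1, f q.2))) (G := c \o snd)) => //.
  - apply: (cts_comp (g := g)) => //; apply: (cts_comp (g := E)) => //.
    by apply: cts_pair; [cts|apply: cts_comp => //; cts].
  - by apply: (cts_comp (f := snd)) => //; cts.
  - by move=> t; rewrite fx Ey -c0.
(* follow the homotopy H, dragging the rest of the trace *)
apply: (homotopic_rel_trans (g := drag D u id (fun=> x))).
  apply: (homotopic_rel_ext
    (f := drag D u (fun z => H (0, z)) (fun s => c (0 + s * (1 - 0))))
    (g := drag D u (fun z => H (1, z)) (fun s => c (1 + s * (1 - 1))))).
  - by move=> z; rewrite /drag add0r subr0 mulr1 H0.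
  - by move=> z; rewrite /drag subrr mulr0 addr0 /c !H1.
  apply: (homotopic_drag cD cu ux Du (F := H)
    (G := fun q => c (q.1 + q.2 * (1 - q.1)))) => //.
  - by apply: (cts_comp (g := c)) => //; cts.
  - by move=> t; rewrite mul0r addr0.
  - by move=> t; rewrite !mul1r add0r subr0 addrC subrK.
apply: (homotopic_rel_ext (f := id \o D \o pair 1) (g := id)) => //.
  by move=> z; rewrite (drag_cst Du id).
apply: homotopic_rel_sym.
by apply: (homotopic_retract (x := x) cD D0 Dx) => //; exact: cts_id.
Qed.

(** The left inverse of [f] is itself a free equivalence, so it has a pointed
    left inverse too; having inverses on both sides, it inverts [f]. *)
Lemma pointed_equiv (X Y : topologicalType) (x : X) (f : X -> Y) :
  well_pointed x -> well_pointed (f x) ->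
  equiv_rel (R := R) set0 set0 f -> equiv_rel (R := R) [set x] [set f x] f.
Proof.
move=> wx wy ef; have [g [eg gx gf]] := pointed_left_inverse wx wy erefl ef.
have [h [eh hx hg]] := pointed_left_inverse wy wx gx eg.
have [cf _ _] := ef; have [cg _ _] := eg; have [ch _ _] := eh.
split => //; first by move=> _ ->.
exists g; split => //; first by move=> _ ->.
(* h ~ h g f ~ f, so f g ~ h g ~ id *)
have hf : homotopic_rel (R := R) [set x] h f.
  apply: (homotopic_rel_trans (g := h \o (g \o f))).
    by apply: homotopic_rel_sym; exact: (homotopic_rel_comp ch gf).
  apply: (homotopic_rel_ext (f := h \o g \o f) (g := id \o f)) => //.
  by apply: (homotopic_rel_precomp (A := [set f x])) => // _ ->.
apply: homotopic_rel_trans hg.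
apply: (homotopic_rel_precomp (A := [set x])) => // [_ -> //|].
exact: homotopic_rel_sym.
Qed.

Lemma wedge2_equiv (X X' Y Y' : topologicalType) (x : X) (y : Y)
    (f : X -> X') (f' : Y -> Y') :
  equiv_rel (R := R) [set x] [set f x] f ->
  equiv_rel (R := R) [set y] [set f' y] f' ->
  heq R (wedge2 x y) (wedge2 (f x) (f' y)).
Proof.
move=> [cf _ [g [cg gx gf fg]]] [cf' _ [g' [cg' gy gf' fg']]].
have gfx : g (f x) = x by apply: gx.
have gfy : g' (f' y) = y by apply: gy.
pose F : wedge2 x y -> wedge2 (f x) (f' y) := welim (winl \o f) (winr \o f').
pose G : wedge2 (f x) (f' y) -> wedge2 x y := welim (winl \o g) (winr \o g').
have eF : (winl \o f) x = (winr \o f') y :> wedge2 (f x) (f' y).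
  exact: winl_winr.
have eG : (winl \o g) (f x) = (winr \o g') (f' y) :> wedge2 x y.
  by rewrite /= gfx gfy; exact: winl_winr.
have Fl z : F (winl z) = winl (f z) by exact: (welim_l eF).
have Fr z : F (winr z) = winr (f' z) by exact: (welim_r eF).
have Gl z : G (winl z) = winl (g z) by exact: (welim_l eG).
have Gr z : G (winr z) = winr (g' z) by exact: (welim_r eG).
have cl := @winl_continuous; have cr := @winr_continuous.
exists F; split => //.
  by apply: cts_welim => //; apply: cts_comp => //.
exists G; split => //.
- by apply: cts_welim => //; apply: cts_comp => //.
- have [H [cH H0 H1 Hx]] := gf; have [K [cK K0 K1 Ky]] := gf'.
  apply: (homotopic_rel_wedge2 (HX := winl \o H) (HY := winr \o K)) => //=.
  + exact: cts_comp.
  + exact: cts_comp.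
  + by move=> t; rewrite Hx // Ky //= gfx gfy winl_winr.
  + by move=> z; rewrite H0 Fl Gl.
  + by move=> z; rewrite K0 Fr Gr.
  + by move=> z; rewrite H1.
  + by move=> z; rewrite K1.
- have [H [cH H0 H1 Hx]] := fg; have [K [cK K0 K1 Ky]] := fg'.
  apply: (homotopic_rel_wedge2 (HX := winl \o H) (HY := winr \o K)) => //=.
  + exact: cts_comp.
  + exact: cts_comp.
  + by move=> t; rewrite Hx // Ky //= gfx gfy winl_winr.
  + by move=> z; rewrite H0 Gl Fl.
  + by move=> z; rewrite K0 Gr Fr.
  + by move=> z; rewrite H1.
  + by move=> z; rewrite K1.
Qed.

End WellPointed.
Arguments locally_well_pointed R X : clear implicits.
Section LocallyWellPointedWedge.
Context {R : realType}.

(** At the gluing point, contract both summands; at any other point, contract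
    its own summand away from the gluing point and leave the other one fixed. *)
Lemma locally_well_pointed_wedge2 (X Y : topologicalType) (x0 : X) (y0 : Y) :
  locally_well_pointed R X -> locally_well_pointed R Y ->
  locally_well_pointed R (wedge2 x0 y0).
Proof.
move=> wX wY w N nN.
have nl x : w = winl x -> nbhs x (winl @^-1` N).
  by move=> e; apply: winl_continuous; rewrite -e.
have nr y : w = winr y -> nbhs y (winr @^-1` N).
  by move=> e; apply: winr_continuous; rewrite -e.
have cl := @winl_continuous X Y x0 y0; have cr := @winr_continuous X Y x0 y0.
(* contractions of both summands that agree on the base point glue *)
have glue (DX : R * X -> X) (uX : X -> R) (DY : R * Y -> Y) (uY : Y -> R) :
    continuous DX -> continuous uX -> continuous DY -> continuous uY ->
    (forall t, DX (t, x0) = x0) -> (forall t, DY (t, y0) = y0) ->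
    uX x0 = uY y0 ->
    (forall z, DX (0, z) = z) -> (forall z, DY (0, z) = z) ->
    (forall t x, w = winl x -> DX (t, x) = x) ->
    (forall t y, w = winr y -> DY (t, y) = y) ->
    (forall x, w = winl x -> uX x = 1) -> (forall y, w = winr y -> uY y = 1) ->
    (forall x, uX x = 1 -> w = winl x) -> (forall y, uY y = 1 -> w = winr y) ->
    (forall x, 0 <= uX x -> w = winl (DX (1, x))) ->
    (forall y, 0 <= uY y -> w = winr (DY (1, y))) ->
    (forall x, ~ N (winl x) -> uX x < 0 /\ forall t, DX (t, x) = x) ->
    (forall y, ~ N (winr y) -> uY y < 0 /\ forall t, DY (t, y) = y) ->
    well_pointed_in w N (R := R).
  move=> cDX cuX cDY cuY DX0 DY0 u0 DXi DYi Dwx Dwy uwx uwy ux1 uy1 Dx1 Dy1 NX NY.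
  pose D (q : R * wedge2 x0 y0) := welim (fun x => winl (DX (q.1, x)))
    (fun y => winr (DY (q.1, y))) q.2 : wedge2 x0 y0.
  pose u : wedge2 x0 y0 -> R := welim uX uY.
  have e t : winl (DX (t, x0)) = winr (DY (t, y0)) :> wedge2 x0 y0.
    by rewrite DX0 DY0 winl_winr.
  have Dl t x : D (t, winl x) = winl (DX (t, x)) by exact: (welim_l (f := fun x => winl (DX (t, x)))
      (g := fun y => winr (DY (t, y))) (e t)).
  have Dr t y : D (t, winr y) = winr (DY (t, y)) by exact: (welim_r (f := fun x => winl (DX (t, x)))
      (g := fun y => winr (DY (t, y))) (e t)).
  have ul x : u (winl x) = uX x by exact: (welim_l u0).
  have ur y : u (winr y) = uY y by exact: (welim_r u0).
  exists D, u; split; split.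
  - apply: cts_wedge2_joint.
      rewrite (_ : (fun _ => _) = winl \o DX); first exact: cts_comp.
      by apply/funext => -[t x]; rewrite Dl.
    rewrite (_ : (fun _ => _) = winr \o DY); first exact: cts_comp.
    by apply/funext => -[t x]; rewrite Dr.
  - exact: cts_welim.
  - by apply: wedge2_ext => z; rewrite ?Dl ?Dr ?DXi ?DYi.
  - move=> t; have [[x wx]|[y wy]] := wedge2P w.
      by rewrite {1}wx Dl Dwx.
    by rewrite {1}wy Dr Dwy.
  - have [[x wx]|[y wy]] := wedge2P w; first by rewrite {1}wx ul uwx.
    by rewrite {1}wy ur uwy.
  - move=> z; have [[x ->]|[y ->]] := wedge2P z; rewrite ?ul ?ur => h.
      by symmetry; exact: ux1.
    by symmetry; exact: uy1.
  - move=> z; have [[x ->]|[y ->]] := wedge2P z; rewrite ?ul ?ur => h.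
      by rewrite Dl; symmetry; exact: Dx1.
    by rewrite Dr; symmetry; exact: Dy1.
  - move=> z; have [[x ->]|[y ->]] := wedge2P z => /[dup] Nz.
      by move=> /NX [? Dt]; rewrite ul; split => // t; rewrite Dl Dt.
    by move=> /NY [? Dt]; rewrite ur; split => // t; rewrite Dr Dt.
have csnd (Z : topologicalType) : continuous (fun q : R * Z => q.2) by cts.
have [wbase|wbase] := pselect (w = winl x0).
  have wbase' : w = winr y0 by rewrite wbase winl_winr.
  have [DX [uX [[cDX cuX DX0 DXx] [ux ux1 Dx1 NX]]]] := wX _ _ (nl _ wbase).
  have [DY [uY [[cDY cuY DY0 DYy] [uy uy1 Dy1 NY]]]] := wY _ _ (nr _ wbase').
  apply: (glue DX uX DY uY) => //.
  - by rewrite ux uy.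
  - by move=> t x; rewrite wbase => /winl_inj <-.
  - by move=> t x; rewrite wbase' => /winr_inj <-.
  - by move=> x; rewrite wbase => /winl_inj <-.
  - by move=> x; rewrite wbase' => /winr_inj <-.
  - by move=> x /ux1 ->.
  - by move=> y /uy1 ->.
  - by move=> x /Dx1 ->.
  - by move=> y /Dy1 ->.
have [[x wx]|[y wy]] := wedge2P w.
  have xx0 : x <> x0 by move=> e; apply: wbase; rewrite wx e.
  have nN0 : nbhs x ((winl @^-1` N) `&` ~` [set x0]).
    apply: filterI; first exact: nl.
    apply: open_nbhs_nbhs; split => //; apply: closed_openC.
    by apply: closed_point; exact: locally_well_pointedW wX.
  have [D [u [[cD cu D0 Dx] [ux u1 D1 ND]]]] := wX _ _ nN0.
  have [ux0 Dx0] : u x0 < 0 /\ forall t, D (t, x0) = x0 by apply: ND => -[_]; exact.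
  have nwr z : w <> winr z.
    by rewrite wx => /winl_eq_winr [].
  apply: (glue D u snd (fun=> u x0)) => //.
  - exact: cts_cst.
  - by move=> t z; rewrite wx => /winl_inj <-.
  - by move=> z; rewrite wx => /winl_inj <-.
  - by move=> z /nwr.
  - by move=> z /u1 ->.
  - by move=> z h; move: ux0; rewrite h ltr10.
  - by move=> z /D1 ->.
  - by move=> z h; move: ux0; rewrite ltNge; move: h => /= ->.
  - by move=> z Nz; apply: ND => -[/Nz].
have yy0 : y <> y0 by move=> e; apply: wbase; rewrite wy e winl_winr.
have nN0 : nbhs y ((winr @^-1` N) `&` ~` [set y0]).
  apply: filterI; first exact: nr.
  apply: open_nbhs_nbhs; split => //; apply: closed_openC.
  by apply: closed_point; exact: locally_well_pointedW wY.
have [D [u [[cD cu D0 Dx] [ux u1 D1 ND]]]] := wY _ _ nN0.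
have [ux0 Dx0] : u y0 < 0 /\ forall t, D (t, y0) = y0 by apply: ND => -[_]; exact.
have nwr z : w <> winl z.
  by rewrite wy => /esym/winl_eq_winr [].
apply: (glue snd (fun=> u y0) D u) => //.
- exact: cts_cst.
- by move=> t z; rewrite wy => /winr_inj <-.
- by move=> z /nwr.
- by move=> z; rewrite wy => /winr_inj <-.
- by move=> z h; move: ux0; rewrite h ltr10.
- by move=> z /u1 ->.
- by move=> z h; move: ux0; rewrite ltNge; move: h => /= ->.
- by move=> z /D1 ->.
- by move=> z Nz; apply: ND => -[/Nz].
Qed.

End LocallyWellPointedWedge.

(** * Round spheres *)

Section Spheres.
Context {R : realType}.

Definition scoord n (v : sphere R n) (i : 'I_n) : R := set_val v ord0 i.

Lemma scoord_sum n (v : sphere R n) : \sum_i scoord v i ^+ 2 = 1.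
Proof. exact: (set_mem (valP v)). Qed.

Lemma scoord_inj n (v w : sphere R n) : scoord v =1 scoord w -> v = w.
Proof.
move=> e; apply: val_inj; apply/rowP => i.
exact: (e i).
Qed.

Lemma cts_scoord n (i : 'I_n) : continuous (fun v : sphere R n => scoord v i).
Proof.
apply: (cts_comp (f := set_val) (g := fun v : 'rV[R]_n => v ord0 i)).
  exact: initial_continuous.
exact: coord_continuous.
Qed.

Lemma cts_sphere n (X : topologicalType) (f : X -> sphere R n) :
  (forall i, continuous (fun x => scoord (f x) i)) -> continuous f.
Proof.
move=> cf; apply: continuous_comp_initial => x U [P nP PU].
apply: (@filterS _ _ _ [set z | forall i, P ord0 i (scoord (f z) i)]).
  by move=> z Pz; apply: PU => i j /=; rewrite (ord1 i); exact: Pz.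
apply: filter_forall => i; apply: (cf i x); exact: nP.
Qed.

Lemma mksphere_subproof n (F : 'I_n -> R) :
  \sum_i F i ^+ 2 != 0 ->
  [set v : 'rV[R]_n | \sum_i v 0 i ^+ 2 = 1]
    (\row_i (F i / Num.sqrt (\sum_j F j ^+ 2))).
Proof.
move=> F0 /=.
have s0 : 0 <= \sum_i F i ^+ 2 by apply: sumr_ge0 => i _; exact: sqr_ge0.
under eq_bigr do rewrite mxE exprMn exprVn sqr_sqrtr //.
by rewrite -mulr_suml divff.
Qed.

Definition normalize n (F : 'I_n -> R) (F0 : \sum_i F i ^+ 2 != 0) :
  sphere R n := SigSub (mem_set (mksphere_subproof F0)) : set_type _.

Lemma scoord_normalize n (F : 'I_n -> R) (F0 : \sum_i F i ^+ 2 != 0) i :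
  scoord (normalize F0) i = F i / Num.sqrt (\sum_j F j ^+ 2).
Proof. by rewrite /scoord /normalize /= mxE. Qed.

End Spheres.
Section SphereWellPointed.
Context {R : realType} {n : nat}.
Implicit Types p v : sphere R n.

Definition l1dist p v : R := \sum_i `|scoord v i - scoord p i|.

Lemma cts_l1dist p : continuous (l1dist p).
Proof.
by apply: cts_sum => i; cts; exact: cts_scoord.
Qed.

Lemma coord_le_l1dist p v i : `|scoord v i - scoord p i| <= l1dist p v.
Proof. by rewrite /l1dist (bigD1 i) //= lerDl sumr_ge0. Qed.

Lemma l1dist_eq0 p v : l1dist p v = 0 -> v = p.
Proof.
move=> d0; apply: scoord_inj => i; apply/eqP; rewrite -subr_eq0 -normr_le0.
by rewrite -d0 coord_le_l1dist.
Qed.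

Lemma sphere_nbhs p (N : set (sphere R n)) :
  nbhs p N -> exists2 e : R, 0 < e & forall v, l1dist p v < e -> N v.
Proof.
move=> [? /= [[W oW <-]] /= Wp sub].
have /nbhs_ballP[e e0 eW] : nbhs (set_val p) W by exact: open_nbhs_nbhs.
exists e => // v dv; apply: sub; apply: eW; split => // i j.
rewrite /ball /= (ord1 i) distrC; apply: le_lt_trans dv.
exact: coord_le_l1dist.
Qed.

(** Close to [p], the straight segment towards [p] avoids the origin. *)
Lemma segment_neq0 p v (s : R) : 0 <= s <= 1 -> (s != 0 -> l1dist p v < 1) ->
  \sum_i ((1 - s) * scoord v i + s * scoord p i) ^+ 2 != 0.
Proof.
move=> /andP[s0 s1] sd.
have [s_eq0|sn0] := eqVneq s 0.
  rewrite (_ : \sum_i _ = 1) ?oner_eq0 //; apply: etrans (scoord_sum v).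
  by apply: eq_bigr => i _; rewrite s_eq0 subr0 mul1r mul0r addr0.
have d1 := sd sn0; apply/eqP => /psumr_eq0P sum0.
have w0 i : scoord v i = s * (scoord v i - scoord p i).
  have /eqP := sum0 (fun i _ => sqr_ge0 _) i isT.
  by rewrite sqrf_eq0 => /eqP h; rewrite mulrBr; lra.
have := scoord_sum v; apply/eqP; rewrite lt_eqF //.
apply: le_lt_trans (d1); apply: ler_sum => i _.
have s2 : s ^+ 2 <= 1 by rewrite expr_le1.
rewrite {1}w0 exprMn -[leRHS]mul1r ler_pM ?sqr_ge0 //.
rewrite -[leLHS]real_normK ?num_real // expr2 -[leRHS]mul1r ler_wpM2r //.
by apply: ltW; apply: le_lt_trans d1; exact: coord_le_l1dist.
Qed.

(** Near [p], slide points towards [p] along segments and project back to the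
    sphere; the sliding is damped out at distance [e]. *)
Lemma locally_well_pointed_sphere : locally_well_pointed R (sphere R n).
Proof.
move=> p N /sphere_nbhs [e' e'0 dN'].
(* distance at most 1 keeps the segments away from the origin *)
pose e := Num.min 1 e'.
have e0 : 0 < e by rewrite /e lt_min ltr01.
have e1 : e <= 1 by rewrite /e ge_min lexx.
have dN v : l1dist p v < e -> N v.
  by move=> de; apply: dN'; apply: lt_le_trans de _; rewrite /e ge_min lexx orbT.
pose u v := 1 - 2 / e * l1dist p v.
have cu : continuous u by rewrite /u; cts; exact: cts_l1dist.
have e20 : 0 < 2 / e by rewrite divr_gt0.
pose s (q : R * sphere R n) := clamp q.1 * clamp (1 + u q.2).
have s01 q : 0 <= s q <= 1.
  have /andP[a0 a1] := clamp_bounds q.1.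
  have /andP[b0 b1] := clamp_bounds (1 + u q.2).
  by rewrite /s mulr_ge0 //= mulr_ile1.
have far v : e <= l1dist p v -> 1 + u v <= 0.
  move=> ed; rewrite /u; have : 2 / e * e <= 2 / e * l1dist p v.
    by rewrite ler_pM2l.
  by rewrite divfK ?gt_eqF //; lra.
have clamp_le0 (t : R) : t <= 0 -> clamp t = 0.
  move=> t0; rewrite /clamp min_r ?max_l //.
  by apply: le_trans t0 _; exact: ler01.
have s_neq0 q : s q != 0 -> l1dist p q.2 < 1.
  move=> sq; rewrite ltNge; apply/negP => d1; move: sq.
  by rewrite /s (clamp_le0 (1 + u q.2)) ?mulr0 ?eqxx // far // (le_trans e1).
pose D q := normalize (segment_neq0 (s01 q) (s_neq0 q)).
have DE q i : scoord (D q) i = ((1 - s q) * scoord q.2 i + s q * scoord p i) /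
    Num.sqrt (\sum_j ((1 - s q) * scoord q.2 j + s q * scoord p j) ^+ 2).
  exact: scoord_normalize.
have cs : continuous s.
  rewrite /s; apply: cts_mul; apply: cts_clamp; cts.
  by apply: (cts_comp (g := u)) => //; cts.
have D_s0 q : s q = 0 -> D q = q.2.
  move=> sq; apply: scoord_inj => i; rewrite DE sq subr0 mul1r mul0r addr0.
  rewrite (_ : \sum_j _ = 1) ?sqrtr1 ?divr1 //; apply: etrans (scoord_sum q.2).
  by apply: eq_bigr => j _; rewrite mul1r mul0r addr0.
have D_s1 q : s q = 1 -> D q = p.
  move=> sq; apply: scoord_inj => i; rewrite DE sq subrr mul1r mul0r add0r.
  rewrite (_ : \sum_j _ = 1) ?sqrtr1 ?divr1 //; apply: etrans (scoord_sum p).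
  by apply: eq_bigr => j _; rewrite mul1r mul0r add0r.
have up : u p = 1.
  by rewrite /u /l1dist big1 ?mulr0 ?subr0 // => i _; rewrite subrr normr0.
exists D, u; split; split => //.
- apply: cts_sphere => i.
  under [X in continuous X]funext do rewrite DE.
  have cF j : continuous (fun q : R * sphere R n =>
      (1 - s q) * scoord q.2 j + s q * scoord p j).
    cts; apply: (cts_comp (f := snd) (g := fun v => scoord v j)); first by cts.
    exact: cts_scoord.
  apply: cts_mul => //; apply: cts_inv.
    move=> q; rewrite sqrtr_eq0 -ltNge lt_def (segment_neq0 (s01 q) (s_neq0 q)) /=.
    by apply: sumr_ge0 => j _; exact: sqr_ge0.
  apply: (cts_comp (g := Num.sqrt)); last exact: sqrt_continuous.
  by apply: cts_sum => j; under [X in continuous X]funext do rewrite expr2; apply: cts_mul; exact: cF.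
- by move=> v; rewrite D_s0 // /s clamp0 mul0r.
- move=> t; apply: scoord_inj => i; rewrite DE /=.
  have E j : (1 - s (t, p)) * scoord p j + s (t, p) * scoord p j = scoord p j.
    by rewrite -mulrDl subrK mul1r.
  rewrite E (_ : \sum_j _ = 1) ?sqrtr1 ?divr1 //; apply: etrans (scoord_sum p).
  by apply: eq_bigr => j _; rewrite E.
- move=> v uv; apply: l1dist_eq0; apply/eqP.
  have : 2 / e * l1dist p v = 0 by move: uv; rewrite /u; lra.
  by move=> /eqP; rewrite mulf_eq0 gt_eqF.
- move=> v uv; rewrite D_s1 // /s /= clamp1 mul1r /clamp min_l ?max_r //.
  by rewrite lerDl.
- move=> v Nv; have ed : e <= l1dist p v.
    by rewrite leNgt; apply/negP => /dN.
  have := far _ ed; split; first by move: (far _ ed); lra.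
  by move=> t; rewrite D_s0 // /s (clamp_le0 (1 + u _)) ?mulr0.
Qed.

End SphereWellPointed.
(** * Wedges of spheres are closed under wedges *)

Section ClosureUnderWedge.
Context {R : realType}.

Lemma heq_refl (X : topologicalType) : heq R X X.
Proof. by exists id; exact: equiv_rel_id. Qed.

Lemma equiv_of_cancel (X Y : topologicalType) (A : set X) (B : set Y)
    (f : X -> Y) (g : Y -> X) :
  continuous f -> continuous g -> cancel f g -> cancel g f ->
  (forall x, A x -> B (f x)) -> (forall y, B y -> A (g y)) ->
  equiv_rel (R := R) A B f.
Proof.
move=> cf cg fK gK AB BA; split => //; exists g; split => //.
- apply: (homotopic_rel_ext (f := id) (g := id)) => //.
    by move=> x /=; rewrite fK.
  by apply: homotopic_rel_refl; exact: cts_id.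
- apply: (homotopic_rel_ext (f := id) (g := id)) => //.
    by move=> x /=; rewrite gK.
  by apply: homotopic_rel_refl; exact: cts_id.
Qed.

Lemma heq_of_cancel (X Y : topologicalType) (f : X -> Y) (g : Y -> X) :
  continuous f -> continuous g -> cancel f g -> cancel g f -> heq R X Y.
Proof. by move=> cf cg fK gK; exists f; apply: (equiv_of_cancel cf cg). Qed.

Section Swap.
Context {X Y : topologicalType} {x : X} {y : Y}.
Definition wswap : wedge2 x y -> wedge2 y x := welim winr winl.

Lemma wswap_l z : wswap (winl z) = winr z.
Proof. by apply: welim_l; rewrite winl_winr. Qed.

Lemma wswap_r z : wswap (winr z) = winl z.
Proof. by apply: welim_r; rewrite winl_winr. Qed.

Lemma cts_wswap : continuous wswap.
Proof.
apply: cts_welim; first by rewrite winl_winr.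
- exact: winr_continuous.
- exact: winl_continuous.
Qed.

End Swap.

Lemma wswapK (X Y : topologicalType) (x : X) (y : Y) :
  cancel (@wswap X Y x y) (@wswap Y X y x).
Proof. by apply: wedge2_ext => z; rewrite ?wswap_l ?wswap_r ?wswap_l. Qed.

Lemma wedge2_assoc (X Y Z : topologicalType) (x : X) (y y' : Y) (z : Z) :
  heq R (wedge2 x (winl y' : wedge2 y z)) (wedge2 (winr y : wedge2 x y') z).
Proof.
set V := wedge2 x _; set W := wedge2 _ z.
have clX := @winl_continuous X _ x (winl y' : wedge2 y z).
have crX := @winr_continuous X _ x (winl y' : wedge2 y z).
have clY := @winl_continuous Y Z y z; have crY := @winr_continuous Y Z y z.
have clX' := @winl_continuous X Y x y'; have crX' := @winr_continuous X Y x y'.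
have clZ := @winl_continuous _ Z (winr y : wedge2 x y') z.
have crZ := @winr_continuous _ Z (winr y : wedge2 x y') z.
pose f2 : wedge2 y z -> W := welim (winl \o winr) winr.
have e2 : (winl \o winr) y = winr z :> W by exact: winl_winr.
have f2l t : f2 (winl t) = winl (winr t) by exact: (welim_l e2).
have f2r t : f2 (winr t) = winr t by exact: (welim_r e2).
pose f : V -> W := welim (winl \o winl) f2.
have e1 : (winl \o winl) x = f2 (winl y') by rewrite f2l /= winl_winr.
have fl t : f (winl t) = winl (winl t) by exact: (welim_l e1).
have fr t : f (winr t) = f2 t by exact: (welim_r e1).
pose g2 : wedge2 x y' -> V := welim winl (winr \o winl).
have e3 : winl x = (winr \o winl) y' :> V by exact: winl_winr.
have g2l t : g2 (winl t) = winl t by exact: (welim_l e3).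
have g2r t : g2 (winr t) = winr (winl t) by exact: (welim_r e3).
pose g : W -> V := welim g2 (winr \o winr).
have e4 : g2 (winr y) = (winr \o winr) z by rewrite g2r /= winl_winr.
have gl t : g (winl t) = g2 t by exact: (welim_l e4).
have gr t : g (winr t) = winr (winr t) by exact: (welim_r e4).
apply: (@heq_of_cancel _ _ f g).
- apply: cts_welim => //; first exact: cts_comp.
  by apply: cts_welim => //; exact: cts_comp.
- apply: cts_welim => //; last exact: cts_comp.
  by apply: cts_welim => //; exact: cts_comp.
- apply: wedge2_ext => t; first by rewrite fl gl g2l.
  rewrite fr; have [[s ->]|[s ->]] := wedge2P t; first by rewrite f2l gl g2r.
  by rewrite f2r gr.
- apply: wedge2_ext => t; last by rewrite gr fr f2r.
  rewrite gl; have [[s ->]|[s ->]] := wedge2P t; first by rewrite g2l fl.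
  by rewrite g2r fr f2l.
Qed.

Lemma wedge2_point_equiv (X : topologicalType) (x : X) (q : set_type [set 0 : R]) :
  heq R (wedge2 x q) X.
Proof.
pose f : wedge2 x q -> X := welim id (fun=> x).
have fl t : f (winl t) = t by exact: (welim_l (f := id)).
have fr t : f (winr t) = x by exact: (welim_r (f := id)).
apply: (@heq_of_cancel _ _ f winl).
- by apply: cts_welim => //; [exact: cts_id|exact: cts_cst].
- exact: winl_continuous.
- apply: wedge2_ext => t; first by rewrite fl.
  rewrite fr winl_winr; congr winr; apply: val_inj.
  by rewrite (set_valP t : _ = 0) (set_valP q : _ = 0).
- by move=> t; rewrite fl.
Qed.

Lemma locally_well_pointed_point :
  locally_well_pointed R (set_type [set 0 : R]).
Proof.
have sing (z z' : set_type [set 0 : R]) : z = z'.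
  by apply: val_inj; rewrite (set_valP z : _ = 0) (set_valP z' : _ = 0).
move=> x N /nbhs_singleton Nx; exists snd, (fun=> 1).
split; split => //.
- by cts.
- exact: cts_cst.
- by move=> z; rewrite (sing z x).
Qed.

Lemma locally_well_pointed_wedge_of_spheres (W : topologicalType) :
  wedge_of_spheres R W -> locally_well_pointed R W.
Proof.
elim => [| |X x k p _ wX].
- exact: locally_well_pointed_sphere.
- exact: locally_well_pointed_point.
- by apply: locally_well_pointed_wedge2 => //; exact: locally_well_pointed_sphere.
Qed.

Definition spherical (X : topologicalType) :=
  exists W, wedge_of_spheres R W /\ heq R X W.

Lemma spherical_heq (X Y : topologicalType) :
  heq R X Y -> spherical Y -> spherical X.
Proof.
move=> XY [W [wW YW]]; exists W; split => //.
exact: equivalent_rel_trans XY YW.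
Qed.

Lemma wedge_of_spheres_spherical (W : topologicalType) :
  wedge_of_spheres R W -> spherical W.
Proof. by move=> wW; exists W; split => //; exact: heq_refl. Qed.

Lemma spherical_attach (X : topologicalType) (x : X) k (p : sphere R k.+1) :
  locally_well_pointed R X -> spherical X -> spherical (wedge2 x p).
Proof.
move=> wX [W [wW [f ef]]].
apply: (@spherical_heq _ (wedge2 (f x) p)).
  apply: (wedge2_equiv (f := f) (f' := id)); last exact: equiv_rel_id.
  apply: pointed_equiv => //; apply: locally_well_pointedW => //.
  exact: locally_well_pointed_wedge_of_spheres.
by apply: wedge_of_spheres_spherical; exact: wedge_of_spheres_attach.
Qed.

(** Induction on the second wedge, peeling off its last sphere [S].  If the
    gluing point lies on the rest of that wedge, [S] is attached at the very
    end; otherwise [S] is attached to the first wedge before the rest is. *)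
Lemma wedge2_of_wedges_of_spheres (V W : topologicalType) (v : V) (w : W) :
  wedge_of_spheres R V -> wedge_of_spheres R W -> spherical (wedge2 v w).
Proof.
move=> wV wW; elim: wW V v wV w => [V v wV w|V v wV w|X x k p wX IH V v wV w].
- by have /esym/eqP := scoord_sum w; rewrite big_ord0 oner_eq0.
- apply: spherical_heq (wedge2_point_equiv v w) _.
  exact: wedge_of_spheres_spherical.
have [[x' ->]|[q ->]] := wedge2P w.
- apply: spherical_heq (wedge2_assoc v x x' p) _.
  apply: spherical_attach; last exact: IH.
  by apply: locally_well_pointed_wedge2;
    exact: locally_well_pointed_wedge_of_spheres.
- apply: (@spherical_heq _ (wedge2 v (wswap (winr q) : wedge2 p x))).
    apply: (wedge2_equiv (f := id) (f' := wswap)); first exact: equiv_rel_id.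
    apply: (equiv_of_cancel (g := wswap)).
    + exact: cts_wswap.
    + exact: cts_wswap.
    + exact: wswapK.
    + exact: wswapK.
    + by move=> _ ->.
    + by move=> _ ->; rewrite wswapK.
  rewrite wswap_r; apply: spherical_heq (wedge2_assoc v p q x) _.
  by apply: IH; exact: wedge_of_spheres_attach.
Qed.

Lemma spherical_wedge2 (X Y : topologicalType) (x : X) (y : Y) :
  well_pointed x (R := R) -> well_pointed y (R := R) ->
  spherical X -> spherical Y -> spherical (wedge2 x y).
Proof.
move=> wx wy [V [wV [f ef]]] [W [wW [g eg]]].
apply: (@spherical_heq _ (wedge2 (f x) (g y))).
  by apply: wedge2_equiv; apply: pointed_equiv => //;
    apply: locally_well_pointedW; exact: locally_well_pointed_wedge_of_spheres.
exact: wedge2_of_wedges_of_spheres.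
Qed.

End ClosureUnderWedge.
Arguments spherical R X : clear implicits.
(** * Independence complexes of induced subgraphs *)

Lemma sum_delta (R : realType) (T : finType) (v : T) :
  \sum_x (x == v)%:R = 1 :> R.
Proof. by rewrite (bigD1 v) //= eqxx big1 ?addr0 // => x /negPf ->. Qed.

Section IndependenceRealization.
Context {R : realType} {T : finType} (e : rel T).
Implicit Types (V U : {set T}) (F : T -> R).

Definition induced_complex V : {set {set T}} :=
  [set A : {set T} | (A \subset V) && independent e A]%SET.

Definition ireal V := realization R (induced_complex V).

Definition bary V (z : ireal V) (x : T) : R := set_val z x.

Lemma bary_inj V (z z' : ireal V) : bary z =1 bary z' -> z = z'.
Proof. by move=> h; apply: val_inj; apply/funext => x; exact: h. Qed.

Lemma bary_ge0 V (z : ireal V) x : 0 <= bary z x.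
Proof. by have [h _ _] := set_valP z; exact: h. Qed.

Lemma bary_sum V (z : ireal V) : \sum_x bary z x = 1.
Proof. by have [_ h _] := set_valP z. Qed.

Lemma bary_supp V (z : ireal V) x : bary z x != 0 -> x \in V.
Proof.
have [_ _] := set_valP z; rewrite inE => /andP[/fintype.subsetP sV _] zx.
by apply: sV; rewrite inE.
Qed.

Lemma bary_out V (z : ireal V) x : x \notin V -> bary z x = 0.
Proof.
by move=> xV; apply/eqP; apply: contraNT xV; exact: bary_supp.
Qed.

Lemma bary_indep V (z : ireal V) x y :
  bary z x != 0 -> bary z y != 0 -> ~~ e x y.
Proof.
have [_ _] := set_valP z; rewrite inE => /andP[_ indep] zx zy.
have /forall_inP/(_ x) := indep; rewrite inE => /(_ zx) /forall_inP/(_ y).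
by rewrite inE; apply.
Qed.

Lemma cts_bary V x : continuous (fun z : ireal V => bary z x).
Proof.
apply: (cts_comp (f := set_val) (g := fun t : prod_topology (fun=> R) => t x)).
  exact: initial_continuous.
exact: (@proj_continuous T (fun=> R) x).
Qed.

Lemma cts_ireal (X : topologicalType) V (f : X -> ireal V) :
  (forall x, continuous (fun p => bary (f p) x)) -> continuous f.
Proof.
move=> cf; apply: continuous_comp_initial => p; apply/cvg_sup => x.
move=> A /= [_ [[B oB <-] Bx sub]].
apply: (filterS sub); apply: (cf x p).
exact: open_nbhs_nbhs.
Qed.

(** Points and continuous maps are produced below from unnormalized weights;
    the division by their total is done once and for all in [scale_point]. *)
Definition cone_point V F :=
  [/\ forall x, 0 <= F x, 0 < \sum_x F x, forall x, F x != 0 -> x \in V &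
      forall x y, F x != 0 -> F y != 0 -> ~~ e x y].

Lemma scale_point_subproof V F : cone_point V F ->
  [set t : prod_topology (fun _ : T => R) |
    [/\ forall x, 0 <= t x, \sum_x t x = 1 &
        [set x : T | t x != 0]%SET \in induced_complex V]]
  (fun x => F x / \sum_y F y).
Proof.
move=> [F0 Fs FV Fe].
have supp x : F x / \sum_y F y != 0 -> F x != 0.
  by apply: contraNneq => ->; rewrite mul0r.
split => /=.
- by move=> x; rewrite divr_ge0 // ltW.
- by rewrite -mulr_suml divff // gt_eqF.
- rewrite inE; apply/andP; split.
    by apply/fintype.subsetP => x; rewrite inE => /supp; exact: FV.
  apply/forall_inP => x; rewrite inE => /supp Fx.
  by apply/forall_inP => y; rewrite inE => /supp; exact: Fe.
Qed.

Definition scale_point V F (h : cone_point V F) : ireal V :=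
  SigSub (mem_set (scale_point_subproof h)) : set_type _.

Lemma bary_scale V F (h : cone_point V F) x :
  bary (scale_point h) x = F x / \sum_y F y.
Proof. by []. Qed.

Lemma cone_point_bary V (z : ireal V) : cone_point V (bary z).
Proof.
split; [exact: bary_ge0|by rewrite bary_sum|exact: bary_supp|].
by move=> x y; exact: bary_indep.
Qed.

Lemma cts_scale (X : topologicalType) V (F : X -> T -> R)
    (h : forall p, cone_point V (F p)) :
  (forall x, continuous (F^~ x)) -> continuous (fun p => scale_point (h p)).
Proof.
move=> cF; apply: cts_ireal => x.
under [X in continuous X]funext do rewrite bary_scale.
apply: cts_mul; first exact: cF.
apply: cts_inv; last exact: cts_sum.
by move=> p; have [_ hs _ _] := h p; rewrite gt_eqF.
Qed.

(** The segment between the two images of a point lies in one simplex. *)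
Lemma contiguous_homotopic (X : topologicalType) V (f g : X -> ireal V)
    (A : set X) :
  continuous f -> continuous g -> (forall p, A p -> f p = g p) ->
  (forall p x y, (bary (f p) x != 0) || (bary (g p) x != 0) ->
    (bary (f p) y != 0) || (bary (g p) y != 0) -> ~~ e x y) ->
  homotopic_rel (R := R) A f g.
Proof.
move=> cf cg fgA fg.
pose F (q : R * X) x :=
  (1 - clamp q.1) * bary (f q.2) x + clamp q.1 * bary (g q.2) x.
have supp q x : F q x != 0 -> (bary (f q.2) x != 0) || (bary (g q.2) x != 0).
  apply: contraNT; rewrite negb_or !negbK => /andP[/eqP fx /eqP gx].
  by rewrite /F fx gx !mulr0 addr0.
have sumF q : \sum_x F q x = 1.
  by rewrite big_split /= -!mulr_sumr !bary_sum !mulr1 subrK.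
have h q : cone_point V (F q).
  have /andP[c0 c1] := clamp_bounds q.1.
  split.
  - move=> x; rewrite addr_ge0 // mulr_ge0 ?bary_ge0 //.
    by rewrite subr_ge0.
  - by rewrite sumF.
  - by move=> x /supp /orP[]; exact: bary_supp.
  - by move=> x y /supp Fx /supp; exact: fg.
exists (fun q => scale_point (h q)); split.
- apply: cts_scale => x; have cb := @cts_bary V x.
  have cfx : continuous (fun q : R * X => bary (f q.2) x).
    by apply: (cts_comp (g := fun z : ireal V => bary z x)) => //; apply: cts_comp => //; cts.
  have cgx : continuous (fun q : R * X => bary (g q.2) x).
    by apply: (cts_comp (g := fun z : ireal V => bary z x)) => //; apply: cts_comp => //; cts.
  have cc : continuous (fun q : R * X => clamp q.1) by apply: cts_clamp; cts.
  by rewrite /F; cts.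
- move=> p; apply: bary_inj => x; rewrite bary_scale sumF divr1 /F /=.
  by rewrite clamp0 subr0 mul1r mul0r addr0.
- move=> p; apply: bary_inj => x; rewrite bary_scale sumF divr1 /F /=.
  by rewrite clamp1 subrr mul1r mul0r add0r.
- move=> t p Ap; apply: bary_inj => x; rewrite bary_scale sumF divr1 /F /=.
  by rewrite -(fgA _ Ap) -mulrDl subrK mul1r.
Qed.

Lemma cone_point_inc V V' : V \subset V' -> forall z : ireal V,
  cone_point V' (bary z).
Proof.
move=> /fintype.subsetP VV' z; have [h1 h2 h3 h4] := cone_point_bary z.
by split => // x /h3 /VV'.
Qed.

Definition inc V V' (h : V \subset V') (z : ireal V) : ireal V' :=
  scale_point (cone_point_inc h z).

Lemma bary_inc V V' (h : V \subset V') (z : ireal V) x :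
  bary (inc h z) x = bary z x.
Proof. by rewrite bary_scale bary_sum divr1. Qed.

Lemma cts_inc V V' (h : V \subset V') : continuous (inc h).
Proof. by apply: cts_scale => x; exact: cts_bary. Qed.

Section Vertex.
Hypothesis e_irr : forall x, ~~ e x x.

Lemma cone_point_vertex V v : v \in V -> cone_point V (fun x => (x == v)%:R).
Proof.
move=> vV; split.
- by move=> x; rewrite ler0n.
- by rewrite sum_delta.
- by move=> x; rewrite pnatr_eq0 eqb0 negbK => /eqP ->.
- by move=> x y; rewrite !pnatr_eq0 !eqb0 !negbK => /eqP -> /eqP ->.
Qed.

Definition vertex V v (vV : v \in V) : ireal V :=
  scale_point (cone_point_vertex vV).

Lemma bary_vertex V v (vV : v \in V) x : bary (vertex vV) x = (x == v)%:R.
Proof. by rewrite bary_scale sum_delta divr1. Qed.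

Lemma bary_vertex_neq0 V v (vV : v \in V) x :
  (bary (vertex vV) x != 0) = (x == v).
Proof. by rewrite bary_vertex pnatr_eq0 eqb0 negbK. Qed.

(** A vertex nonadjacent to all others is the apex of a cone. *)
Lemma cone_contractible V v : v \in V -> (forall x, x \in V -> ~~ e v x) ->
  (forall x, x \in V -> ~~ e x v) ->
  heq R (ireal V) (set_type [set 0 : R]).
Proof.
move=> vV ev ve.
pose o : set_type [set 0 : R] := SigSub (mem_set (erefl 0 : [set 0] 0)).
exists (fun=> o); split => //; first exact: cts_cst.
exists (fun=> vertex vV); split => //; first exact: cts_cst.
- apply: contiguous_homotopic => //; [exact: cts_cst|exact: cts_id|].
  move=> z x y /=; rewrite !bary_vertex_neq0.
  move=> /orP[/eqP ->|zx] /orP[/eqP ->|zy]; first exact: e_irr.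
  + by apply: ev; exact: bary_supp zy.
  + by apply: ve; exact: bary_supp zx.
  + exact: bary_indep zx zy.
- apply: (homotopic_rel_ext (f := id) (g := id)) => //.
    by move=> z; apply: val_inj => /=; rewrite (set_valP z : _ = 0).
  by apply: homotopic_rel_refl; exact: cts_id.
Qed.

End Vertex.

(** If every non-neighbour of [w] is a non-neighbour of [v], sliding the weight
    of [w] to [v] stays in the complex. *)
Lemma dominated_vertex V v w :
  symmetric e -> v \in V -> w \in V -> v != w ->
  (forall x, x \in V -> ~~ e x w -> ~~ e x v) -> ~~ e v v -> ~~ e w w ->
  heq R (ireal V) (ireal (V :\ w)).
Proof.
move=> es vV wV vw dom evv eww.
have sub : V :\ w \subset V by rewrite subD1set.
pose F (z : ireal V) x : R :=
  if x == w then 0 else bary z x + (x == v)%:R * bary z w.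
have suppF (z : ireal V) x : F z x != 0 ->
    x != w /\ (bary z x != 0 \/ x = v /\ bary z w != 0).
  rewrite /F; case: (eqVneq x w) => [_|xw h]; first by rewrite eqxx.
  split => //; have [zx|] := eqVneq (bary z x) 0; last by left.
  right; move: h; rewrite zx add0r; case: (eqVneq x v) => [-> /=|_].
    by rewrite mul1r.
  by rewrite mul0r eqxx.
have indF (z : ireal V) x y : (F z x != 0) || (bary z x != 0) ->
    (F z y != 0) || (bary z y != 0) -> ~~ e x y.
  have red t : (F z t != 0) || (bary z t != 0) ->
      bary z t != 0 \/ t = v /\ bary z w != 0.
    by case/orP => [/suppF []|]; [|left].
  move=> /red[zx|[-> zw]] /red[zy|[-> zw']] //.
  - exact: bary_indep zx zy.
  - by apply: dom; [exact: bary_supp zx|exact: bary_indep zx zw'].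
  - rewrite es; apply: dom; first exact: bary_supp zy.
    by rewrite es; exact: bary_indep zw zy.
have sumF (z : ireal V) : \sum_x F z x = 1.
  rewrite (eq_bigr (fun x => bary z x + (x == v)%:R * bary z w
      - (x == w)%:R * bary z w)); last first.
    move=> x _; rewrite /F; case: (eqVneq x w) => [->|_]; last by rewrite mul0r subr0.
    by rewrite eq_sym (negPf vw) mul0r addr0 mul1r subrr.
  rewrite sumrB big_split /= bary_sum -!mulr_suml !sum_delta.
  by rewrite addrK.
have hF z : cone_point (V :\ w) (F z).
  split.
  - move=> x; rewrite /F; case: ifP => // _.
    by rewrite addr_ge0 ?mulr_ge0 ?bary_ge0.
  - by rewrite sumF.
  - move=> x /suppF [xw zx]; rewrite !inE xw /=.
    by case: zx => [|[-> _]] //; exact: bary_supp.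
  - by move=> x y Fx Fy; apply: (indF z); rewrite ?Fx ?Fy.
pose f z := scale_point (hF z).
have bf z x : bary (f z) x = F z x by rewrite bary_scale sumF divr1.
have cf : continuous f.
  apply: cts_scale => x; rewrite /F; cts; exact: cts_bary.
exists f; split => //; exists (inc sub); split => //.
- exact: cts_inc.
- apply: contiguous_homotopic => //.
  + by apply: cts_comp => //; exact: cts_inc.
  + exact: cts_id.
  + by move=> z x y /=; rewrite !bary_inc !bf; exact: indF.
- apply: (homotopic_rel_ext (f := id) (g := id)) => //.
    move=> z; apply: bary_inj => x; rewrite /= bf /F !bary_inc.
    have zw : bary z w = 0 by apply: bary_out; rewrite !inE eqxx.
    by case: (eqVneq x w) => [->|_]; rewrite zw ?mulr0 ?addr0.
  by apply: homotopic_rel_refl; exact: cts_id.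
Qed.

End IndependenceRealization.
(** * Contracting a subcomplex to its apex *)

Section Contraction.
Context {R : realType} {T : finType} (e : rel T).
Hypotheses (e_irr : forall x, ~~ e x x) (e_sym : symmetric e).

(** Let [m] be the weight that a point puts on the vertices of a cone.  For
    [m <= 1/3] the weights outside the cone are multiplied by [1 - 3m]; from
    [m = 1/3] on the point thus lies in the cone, and it is moved to the apex by the
    proportion [(3m - 1)/2], which reaches [1] for [m = 1]. *)
Definition far_weight (m : R) : R := Num.max 0 (1 - 3 * m).
Definition apex_weight (m : R) : R := Num.max 0 (3 * m - 1) / 2.

Variant weight_spec (m : R) : R -> R -> Prop :=
| WeightFar of 3 * m <= 1 : weight_spec m (1 - 3 * m) 0
| WeightNear of 1 < 3 * m : weight_spec m 0 ((3 * m - 1) / 2).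

Lemma weightP m : weight_spec m (far_weight m) (apex_weight m).
Proof.
rewrite /far_weight /apex_weight; case: (lerP (3 * m) 1) => h.
  rewrite max_r ?subr_ge0 // max_l ?subr_le0 // mul0r.
  exact: WeightFar.
rewrite max_l ?subr_le0 1?ltW // max_r ?subr_ge0 1?ltW //.
exact: WeightNear.
Qed.

Lemma cts_far_weight (X : topologicalType) (f : X -> R) :
  continuous f -> continuous (fun p => far_weight (f p)).
Proof. by move=> cf; rewrite /far_weight; cts. Qed.

Lemma cts_apex_weight (X : topologicalType) (f : X -> R) :
  continuous f -> continuous (fun p => apex_weight (f p)).
Proof. by move=> cf; rewrite /apex_weight; cts. Qed.

Section Mass.
Context (U V : {set T}).

Definition mass (z : ireal e V) : R := \sum_(x in U) bary z x.

Lemma cts_mass : continuous mass.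
Proof. by apply: cts_sum => x; exact: cts_bary. Qed.

Lemma mass_ge0 z : 0 <= mass z.
Proof. by apply: sumr_ge0 => x _; exact: bary_ge0. Qed.

Lemma sum_weights z (p q : R) :
  \sum_x (if x \in U then p else q) * bary z x = p * mass z + q * (1 - mass z).
Proof.
rewrite (bigID (mem U)) /= -(bary_sum z) [in RHS](bigID (mem U)) /=.
rewrite -/(mass z) addrAC subrr add0r !mulr_sumr; congr (_ + _).
  by apply: eq_bigr => x ->.
by apply: eq_bigr => x /negPf ->.
Qed.

Lemma mass_le1 z : mass z <= 1.
Proof.
rewrite -(bary_sum z) [leRHS](bigID (mem U)) /= lerDl.
by apply: sumr_ge0 => x _; exact: bary_ge0.
Qed.

Lemma mass1 z : (forall x, bary z x != 0 -> x \in U) -> mass z = 1.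
Proof.
move=> zU; rewrite -(bary_sum z) [RHS](bigID (mem U)) /= [X in _ + X]big1 ?addr0 //.
by move=> x xU; apply/eqP; apply: contraNT xU; exact: zU.
Qed.

End Mass.

Context (U : {set T}) (v : T).
Hypotheses (vU : v \in U) (vN : forall x, x \in U -> ~~ e v x).

Section OneComplex.
Context (V : {set T}) (UV : U \subset V).
Local Notation mass := (mass U).

Definition squeeze_coord (z : ireal e V) x : R :=
  (if x \in U then 1 else far_weight (mass z)) * bary z x.

Definition contract_coord (z : ireal e V) x : R :=
  (if x \in U then 1 - apex_weight (mass z) else far_weight (mass z)) * bary z x
  + apex_weight (mass z) * (x == v)%:R.

Lemma cone_point_squeeze z : cone_point e V (squeeze_coord z).
Proof.
have m0 := mass_ge0 U z; have m1 := mass_le1 U z.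
have supp x : squeeze_coord z x != 0 -> bary z x != 0.
  by apply: contraNneq => h; rewrite /squeeze_coord h mulr0.
split.
- move=> x; rewrite mulr_ge0 ?bary_ge0 //.
  by case: ifP => // _; rewrite /far_weight le_max lexx.
- by rewrite sum_weights; case: weightP => h; nra.
- by move=> x /supp; exact: bary_supp.
- by move=> x y /supp zx /supp; exact: bary_indep zx.
Qed.

Definition squeeze z := scale_point (cone_point_squeeze z).

Lemma contract_supp z x : contract_coord z x != 0 ->
  squeeze_coord z x != 0 \/
  x = v /\ forall y, squeeze_coord z y != 0 -> y \in U.
Proof.
rewrite /contract_coord /squeeze_coord.
case: weightP => h; last first.
  have [xv|xv] := eqVneq x v; last first.
    rewrite mulr0 addr0.
    case: ifP => _ h0; left; last by rewrite mul0r eqxx in h0.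
    by rewrite mul1r; apply: contraNneq h0 => ->; rewrite mulr0.
  move=> _; right; split => // y; case: ifP => // _.
  by rewrite mul0r eqxx.
by rewrite mul0r addr0 subr0; left.
Qed.

Lemma squeeze_supp z x : squeeze_coord z x != 0 -> bary z x != 0.
Proof. by apply: contraNneq => h; rewrite /squeeze_coord h mulr0. Qed.

Lemma contract_indep z x y :
  (contract_coord z x != 0) || (squeeze_coord z x != 0) ->
  (contract_coord z y != 0) || (squeeze_coord z y != 0) -> ~~ e x y.
Proof.
have red t : (contract_coord z t != 0) || (squeeze_coord z t != 0) ->
  squeeze_coord z t != 0 \/ t = v /\ forall y, squeeze_coord z y != 0 -> y \in U.
  by case/orP => [/contract_supp|]; [|left].
move=> /red[zx|[-> zU]] /red[zy|[-> zU']].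
- by apply: (@bary_indep R _ _ _ z); exact: squeeze_supp.
- by rewrite e_sym; apply: vN; exact: zU'.
- by apply: vN; exact: zU.
- exact: e_irr.
Qed.

Lemma cone_point_contract z : cone_point e V (contract_coord z).
Proof.
have m0 := mass_ge0 U z; have m1 := mass_le1 U z.
have a0 : 0 <= far_weight (mass z) by rewrite /far_weight le_max lexx.
have c0 : 0 <= apex_weight (mass z) by rewrite divr_ge0 // le_max lexx.
have c1 : apex_weight (mass z) <= 1 by case: weightP; lra.
split.
- move=> x; apply: addr_ge0; apply: mulr_ge0 => //; last exact: bary_ge0.
  by case: ifP; rewrite ?subr_ge0.
- rewrite /contract_coord big_split /= sum_weights -mulr_sumr sum_delta.
  by case: weightP => h; nra.
- move=> x /contract_supp [/squeeze_supp|[-> _]]; first exact: bary_supp.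
  exact: (fintype.subsetP UV).
- by move=> x y Fx Fy; apply: (contract_indep (z := z)); rewrite ?Fx ?Fy.
Qed.

Definition contract z := scale_point (cone_point_contract z).

Lemma cts_contract_coord x : continuous (contract_coord^~ x).
Proof.
have cm := @cts_mass U V.
have cb := @cts_bary R T e V x.
apply: cts_add; apply: cts_mul => //; last exact: cts_cst.
  apply: cts_if; last exact: cts_far_weight.
  by cts; exact: cts_apex_weight.
exact: cts_apex_weight.
Qed.

Lemma cts_contract : continuous contract.
Proof. by apply: cts_scale => x; exact: cts_contract_coord. Qed.

Lemma cts_squeeze : continuous squeeze.
Proof.
apply: cts_scale => x; have cm := @cts_mass U V.
have cb := @cts_bary R T e V x.
apply: cts_mul => //; apply: cts_if; first exact: cts_cst.
exact: cts_far_weight.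
Qed.

Lemma contract_coord_apex z y : (forall x, bary z x != 0 -> x \in U) ->
  contract_coord z y = (y == v)%:R.
Proof.
move=> /mass1 m1.
rewrite /contract_coord m1; case: weightP => h; first by exfalso; lra.
have -> : (3 * 1 - 1) / 2 = 1 :> R by lra.
by rewrite subrr if_same mul0r add0r mul1r.
Qed.

Lemma contract_apex z : (forall x, bary z x != 0 -> x \in U) ->
  contract z = vertex e_irr (fintype.subsetP UV v vU).
Proof.
move=> zU; apply: bary_inj => x; rewrite bary_vertex bary_scale.
rewrite contract_coord_apex // (eq_bigr (fun y => (y == v)%:R)).
  by rewrite sum_delta divr1.
by move=> y _; exact: contract_coord_apex.
Qed.

(** The contraction is reached in two contiguous steps.  Passing directly from
    the identity could leave the complex, since the apex may be adjacent to
    vertices outside the cone; squeezing first removes these. *)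
Lemma homotopic_contract :
  homotopic_rel (R := R) [set vertex e_irr (fintype.subsetP UV v vU)]
    contract id.
Proof.
set p := vertex _ _.
have pU x : bary p x != 0 -> x \in U by rewrite bary_vertex_neq0 => /eqP ->.
have sc (x : T) (F : T -> R) (h : cone_point e V F) :
    bary (scale_point h) x != 0 -> F x != 0.
  by apply: contraNneq => h0; rewrite bary_scale h0 mul0r.
have sqp : squeeze p = p.
  apply: bary_inj => x; rewrite bary_scale.
  have E y : squeeze_coord p y = bary p y.
    rewrite /squeeze_coord; case: ifP => [_|yU]; first by rewrite mul1r.
    suff -> : bary p y = 0 by rewrite mulr0.
    by apply/eqP; apply: contraFT yU => /pU.
  by rewrite E (eq_bigr _ (fun y _ => E y)) bary_sum divr1.
apply: (homotopic_rel_trans (g := squeeze)).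
  apply: contiguous_homotopic.
  - exact: cts_contract.
  - exact: cts_squeeze.
  - by move=> _ ->; rewrite sqp contract_apex.
  - move=> z x y Hx Hy; apply: (contract_indep (z := z)).
      by case/orP: Hx => /sc ->; rewrite ?orbT.
    by case/orP: Hy => /sc ->; rewrite ?orbT.
apply: contiguous_homotopic.
- exact: cts_squeeze.
- exact: cts_id.
- by move=> _ ->; rewrite sqp.
- move=> z x y Hx Hy; apply: (@bary_indep R _ _ _ z).
    by case/orP: Hx => // /sc /squeeze_supp.
  by case/orP: Hy => // /sc /squeeze_supp.
Qed.

End OneComplex.

Lemma contract_coord_ext V V' (z : ireal e V) (z' : ireal e V') x :
  bary z =1 bary z' -> contract_coord z x = contract_coord z' x.
Proof.
move=> zz'; rewrite /contract_coord zz'.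
by have -> : mass U z = mass U z' by apply: eq_bigr => y _; exact: zz'.
Qed.

End Contraction.

(** The open star of the vertex contracts to it. *)
Lemma well_pointed_vertex (R : realType) (T : finType) (e : rel T)
    (e_irr : forall x, ~~ e x x) (e_sym : symmetric e) (V : {set T}) v
    (vV : v \in V) :
  well_pointed (vertex e_irr vV : ireal (R := R) e V) (R := R).
Proof.
have v1 : v \in [set v]%SET by rewrite inE.
have vN x : x \in [set v]%SET -> ~~ e v x by rewrite inE => /eqP ->.
have UV : [set v]%SET \subset V by rewrite finset.sub1set.
have E := homotopic_contract (R := R) e_irr e_sym v1 vN UV.
have [H [cH H0 H1 Hx]] := homotopic_rel_sym E.
have pE : vertex e_irr (fintype.subsetP UV v v1) = vertex e_irr vV :> ireal (R := R) e V.
  by apply: bary_inj => x; rewrite !bary_vertex.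
rewrite pE in Hx.
pose m (z : ireal (R := R) e V) : R := mass [set v]%SET z.
have mE (z : ireal (R := R) e V) : m z = bary z v by rewrite /m /mass big_set1.
exists H, (fun z => (3 * m z - 1) / 2); split; split => //.
- have cm := @cts_mass R T e [set v]%SET V; rewrite /m; cts.
- by move=> t; rewrite Hx.
- by rewrite mE bary_vertex eqxx mulr1; lra.
- move=> z h; have z1 : bary z v = 1 by move: h => /=; rewrite mE; lra.
  apply: bary_inj => x; rewrite bary_vertex; case: eqVneq => [->//|xv].
  have := bary_sum z; rewrite (bigD1 v) //= z1 => /eqP.
  rewrite -subr_eq0 addrAC subrr add0r => /eqP /psumr_eq0P; apply => //.
  by move=> y _; exact: bary_ge0.
- move=> z h; rewrite H1 -pE; apply: bary_inj => x.
  rewrite bary_vertex bary_scale.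
  have z3 : 1 <= 3 * m z by move: h => /=; lra.
  pose c := apex_weight (m z).
  have E' y : contract_coord [set v]%SET v z y =
      ((1 - c) * m z + c) * (y == v)%:R.
    have far0 : far_weight (m z) = 0.
      by rewrite /far_weight max_l // subr_le0.
    rewrite /contract_coord -/(m z) -/c far0 inE.
    case: eqVneq => [->|_]; last by rewrite mul0r !mulr0 addr0.
    by rewrite -mE !mulr1.
  rewrite E' (eq_bigr _ (fun y _ => E' y)) -mulr_sumr sum_delta mulr1.
  rewrite mulrAC divff ?mul1r // gt_eqF // /c.
  have m1 : m z <= 1 := mass_le1 _ z.
  by case: weightP => h'; nra.
- by move=> z [].
Qed.
(** * Splitting a complex along a cone *)

Section Splitting.
Context {R : realType} {T : finType} (e : rel T).
Hypotheses (e_irr : forall x, ~~ e x x) (e_sym : symmetric e).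
Context (V1 V2 : {set T}) (v : T).
Let V := V1 :|: V2.
Let U := V1 :&: V2.
Hypotheses (vU : v \in U) (vN : forall x, x \in U -> ~~ e v x)
  (crossing : forall x y, x \in V1 -> x \notin V2 -> y \in V2 -> y \notin V1 ->
    e x y).

Let UV : U \subset V. Proof. by rewrite finset.subIset ?finset.subsetUl. Qed.

Section Side.
Context (W W' : {set T}) (UW : U \subset W) (WV : W \subset V)
  (WW'U : forall x, x \in W -> x \in W' -> x \in U).

Definition outside (X : {set T}) (z : ireal e V) : R :=
  \sum_(x | x \notin X) bary z x.

Lemma outside0 (X : {set T}) z : outside X z = 0 -> forall x, bary z x != 0 -> x \in X.
Proof.
move=> /psumr_eq0P h x; apply: contraNT => xX; apply/eqP.
by apply: h => // y _; exact: bary_ge0.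
Qed.

Lemma outside_inc (X : {set T}) (XV : X \subset V) (z : ireal e X) :
  outside X (inc XV z) = 0.
Proof. by apply: big1 => x xX; rewrite bary_inc bary_out. Qed.

Lemma cts_outside (X : {set T}) : continuous (outside X).
Proof. by apply: cts_sum => x; exact: cts_bary. Qed.

Hypothesis cover : forall z, outside W z = 0 \/ outside W' z = 0.

(** The contraction followed by the projection to the summand on [W], which
    sends the rest of the complex to the apex. *)
Definition side_coord (z : ireal e V) x : R :=
  if outside W z == 0 then contract_coord U v z x else (x == v)%:R.

Lemma cone_point_side z : cone_point e W (side_coord z).
Proof.
rewrite /side_coord; case: eqP => [/outside0 zW|_]; last first.
  apply: cone_point_vertex => //; exact: (fintype.subsetP UW).
have [h1 h2 h3 h4] := cone_point_contract e_irr e_sym vU vN UV z.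
split => // x /contract_supp [/squeeze_supp|[-> _]]; first exact: zW.
exact: (fintype.subsetP UW).
Qed.

Definition side z : ireal e W := scale_point (cone_point_side z).

Lemma cts_side : continuous side.
Proof.
apply: cts_scale => x.
apply: (@cts_paste _ _ [set z | outside W z = 0] [set z | outside W' z = 0]
  (fun z => contract_coord U v z x) (fun=> (x == v)%:R)).
- by apply: closed_zero; exact: cts_outside.
- by apply: closed_zero; exact: cts_outside.
- by rewrite -subTset => z _; exact: cover.
- exact: cts_contract_coord.
- exact: cts_cst.
- by move=> z /= zW; rewrite /side_coord zW eqxx.
- move=> z /= zW'; rewrite /side_coord; case: eqP => // zW.
  apply: contract_coord_apex => y zy.
  by apply: WW'U; [exact: outside0 zW _ zy|exact: outside0 zW' _ zy].
Qed.

Lemma side_contract z : outside W z = 0 ->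
  bary (side z) =1 bary (contract e_irr e_sym vU vN UV z).
Proof.
move=> zW x; rewrite !bary_scale.
have E y : side_coord z y = contract_coord U v z y.
  by rewrite /side_coord zW eqxx.
by rewrite E (eq_bigr _ (fun y _ => E y)).
Qed.

Lemma side_inc (z : ireal e W) :
  side (inc WV z) = contract e_irr e_sym vU vN UW z.
Proof.
apply: bary_inj => x; rewrite side_contract ?outside_inc // !bary_scale.
have E y : contract_coord U v (inc WV z) y = contract_coord U v z y.
  by apply: contract_coord_ext => t; rewrite bary_inc.
by rewrite E (eq_bigr _ (fun y _ => E y)).
Qed.

Lemma side_apex z : outside W z = 0 -> outside W' z = 0 ->
  side z = vertex e_irr (fintype.subsetP UW v vU).
Proof.
move=> zW zW'; apply: bary_inj => x; rewrite side_contract //.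
rewrite contract_apex ?bary_vertex // => y zy.
by apply: WW'U; [exact: outside0 zW _ zy|exact: outside0 zW' _ zy].
Qed.

End Side.

Let U1 : U \subset V1. Proof. exact: finset.subsetIl. Qed.
Let U2 : U \subset V2. Proof. exact: finset.subsetIr. Qed.
Let V1V : V1 \subset V. Proof. exact: finset.subsetUl. Qed.
Let V2V : V2 \subset V. Proof. exact: finset.subsetUr. Qed.
Let in12 x : x \in V1 -> x \in V2 -> x \in U.
Proof. by move=> h1 h2; rewrite inE h1. Qed.
Let in21 x : x \in V2 -> x \in V1 -> x \in U.
Proof. by move=> h1 h2; rewrite inE h1 andbT. Qed.

Lemma sides_cover (z : ireal (R := R) e V) :
  outside V1 z = 0 \/ outside V2 z = 0.
Proof.
have [/existsP[x /andP[x1 zx]]|/existsPn h] :=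
  boolP [exists x, (x \notin V1) && (bary z x != 0)]; last first.
  left; apply: big1 => x xV; apply/eqP.
  by have := h x; rewrite xV /= negbK.
right; apply: big1 => y yV2; apply/eqP; apply/negPn/negP => zy.
have := bary_supp zx; rewrite inE (negPf x1) /= => x2.
have := bary_supp zy; rewrite inE (negPf yV2) orbF => y1.
by have := bary_indep zy zx; rewrite crossing.
Qed.

Let cover' (z : ireal (R := R) e V) : outside V2 z = 0 \/ outside V1 z = 0.
Proof. by have [] := sides_cover z; [right|left]. Qed.

Local Notation p1 := (vertex e_irr (fintype.subsetP U1 v vU) : ireal (R := R) e V1).
Local Notation p2 := (vertex e_irr (fintype.subsetP U2 v vU) : ireal (R := R) e V2).

(** Contracting the common cone to its apex sends each of the two parts to
    itself, hence the whole complex to their wedge at the apex. *)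
Lemma ireal_wedge2 : heq R (ireal (R := R) e V) (wedge2 p1 p2).
Proof.
pose s1 : ireal (R := R) e V -> ireal e V1 := side U1.
pose s2 : ireal (R := R) e V -> ireal e V2 := side U2.
pose f (z : ireal (R := R) e V) : wedge2 p1 p2 :=
  if outside V1 z == 0 then winl (s1 z) else winr (s2 z).
have f1 z : outside V1 z = 0 -> f z = winl (s1 z).
  by move=> z1; rewrite /f z1 eqxx.
have f2 z : outside V2 z = 0 -> f z = winr (s2 z).
  move=> z2; rewrite /f; case: eqP => // z1.
  rewrite /s1 (side_apex _ in12) // /s2 (side_apex _ in21) //.
  exact: winl_winr.
pose g : wedge2 p1 p2 -> ireal (R := R) e V := welim (inc V1V) (inc V2V).
have e0 : inc V1V p1 = inc V2V p2 :> ireal (R := R) e V.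
  by apply: bary_inj => x; rewrite !bary_inc !bary_vertex.
have gl z : g (winl z) = inc V1V z by exact: (welim_l e0).
have gr z : g (winr z) = inc V2V z by exact: (welim_r e0).
have cl := @winl_continuous _ _ p1 p2; have cr := @winr_continuous _ _ p1 p2.
have cf : continuous f.
  apply: (@cts_paste _ _ [set z | outside V1 z = 0] [set z | outside V2 z = 0]
    (winl \o s1) (winr \o s2)) => //.
  - by apply: closed_zero; exact: cts_outside.
  - by apply: closed_zero; exact: cts_outside.
  - by rewrite -subTset => z _; exact: sides_cover.
  - by apply: cts_comp => //; apply: (cts_side in12); exact: sides_cover.
  - by apply: cts_comp => //; apply: (cts_side in21); exact: cover'.
have cg : continuous g by apply: cts_welim => //; exact: cts_inc.
exists f; split => //; exists g; split => //.
- apply: (homotopic_rel_ext (f := contract e_irr e_sym vU vN UV) (g := id)) => //.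
    move=> z; apply: bary_inj => x /=.
    have [z1|z2] := sides_cover z.
      by rewrite f1 // gl bary_inc /s1 side_contract.
    by rewrite f2 // gr bary_inc /s2 side_contract.
  exact: homotopic_rel_sub (homotopic_contract _ _ _ _ _).
- have [H [cH H0 H1 Hp]] := homotopic_contract (R := R) e_irr e_sym vU vN U1.
  have [K [cK K0 K1 Kp]] := homotopic_contract (R := R) e_irr e_sym vU vN U2.
  apply: (homotopic_rel_wedge2 (HX := winl \o H) (HY := winr \o K)) => //=.
  + exact: cts_comp.
  + exact: cts_comp.
  + move=> t; rewrite Hp // Kp // !contract_apex ?winl_winr //.
      by move=> x; rewrite bary_vertex_neq0 => /eqP ->.
    by move=> x; rewrite bary_vertex_neq0 => /eqP ->.
  + by move=> z; rewrite gl f1 ?outside_inc // /s1 side_inc H0.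
  + by move=> z; rewrite gr f2 ?outside_inc // /s2 side_inc K0.
  + by move=> z; rewrite H1.
  + by move=> z; rewrite K1.
Qed.

Lemma spherical_ireal_wedge2 :
  spherical R (ireal (R := R) e V1) -> spherical R (ireal (R := R) e V2) ->
  spherical R (ireal (R := R) e V).
Proof.
move=> s1 s2; apply: spherical_heq ireal_wedge2 _.
by apply: spherical_wedge2 => //; exact: well_pointed_vertex.
Qed.

End Splitting.
(** * Cross-polytopes *)

(** The pairs [a i], [b i] of adjacent vertices, otherwise nonadjacent, are the
    ends of the axes of a cross-polytope; a point of its boundary complex is
    determined by the signed differences of its weights on the axes, up to a
    radial projection. *)
Section CrossPolytope.
Context {R : realType} {T : finType} (e : rel T) (n : nat) (a b : 'I_n -> T).
Hypotheses (a_inj : injective a) (b_inj : injective b)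
  (ab : forall i j, a i != b j) (eab : forall i, e (a i) (b i))
  (eaa : forall i j, ~~ e (a i) (a j)) (ebb : forall i j, ~~ e (b i) (b j))
  (eab' : forall i j, i != j -> ~~ e (a i) (b j) /\ ~~ e (b j) (a i)).
Context (V : {set T}).
Hypothesis VE : forall x, (x \in V) = [exists i, (x == a i) || (x == b i)].

Let aV i : a i \in V.
Proof. by rewrite VE; apply/existsP; exists i; rewrite eqxx. Qed.

Let bV i : b i \in V.
Proof. by rewrite VE; apply/existsP; exists i; rewrite eqxx orbT. Qed.

Let VP x : x \in V -> exists i, x = a i \/ x = b i.
Proof.
by rewrite VE => /existsP[i /orP[]/eqP ->]; exists i; [left|right].
Qed.

Local Notation K := (ireal (R := R) e V).

Let sign_cases (t : R) : t <= 0 \/ 0 < t.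
Proof. by case: (ltP 0 t); [right|left]. Qed.

Lemma antipodal0 (z : K) i : bary z (a i) = 0 \/ bary z (b i) = 0.
Proof.
have [->|za] := eqVneq (bary z (a i)) 0; first by left.
right; apply/eqP/negPn/negP => zb.
by have := bary_indep za zb; rewrite eab.
Qed.

Definition signed (z : K) (i : 'I_n) : R := bary z (a i) - bary z (b i).

Lemma signed_neq0 z : \sum_i signed z i ^+ 2 != 0.
Proof.
apply/eqP => /psumr_eq0P s0.
have z0 i : bary z (a i) = 0 /\ bary z (b i) = 0.
  have /eqP := s0 (fun i _ => sqr_ge0 _) i isT.
  rewrite sqrf_eq0 subr_eq0 => /eqP h.
  by have [h'|h'] := antipodal0 z i; rewrite ?h' -?h ?h' // h h'.
have := bary_sum z; rewrite big1 => [/esym/eqP|x _]; first by rewrite oner_eq0.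
have [/VP[i [->|->]]|xV] := boolP (x \in V); last exact: bary_out.
  by have [] := z0 i.
by have [] := z0 i.
Qed.

Definition to_sphere (z : K) : sphere R n := normalize (signed_neq0 z).

Definition unsigned (w : sphere R n) (x : T) : R :=
  \sum_i ((x == a i)%:R * Num.max 0 (scoord w i) +
          (x == b i)%:R * Num.max 0 (- scoord w i)).

Lemma unsigned_a w i : unsigned w (a i) = Num.max 0 (scoord w i).
Proof.
rewrite /unsigned (bigD1 i) //= eqxx (negPf (ab i i)) mul1r mul0r addr0.
rewrite big1 ?addr0 // => j ji.
by rewrite (negPf (ab i j)) (inj_eq a_inj) eq_sym (negPf ji) !mul0r addr0.
Qed.

Lemma unsigned_b w i : unsigned w (b i) = Num.max 0 (- scoord w i).
Proof.
rewrite /unsigned (bigD1 i) //= eqxx (eq_sym _ (a i)) (negPf (ab i i)).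
rewrite mul1r mul0r add0r big1 ?addr0 // => j ji.
by rewrite (eq_sym _ (a j)) (negPf (ab j i)) (inj_eq b_inj) eq_sym (negPf ji)
  !mul0r addr0.
Qed.

Lemma unsigned_out w x : x \notin V -> unsigned w x = 0.
Proof.
move=> xV; apply: big1 => i _.
have -> : (x == a i) = false by apply: contraNF xV => /eqP ->.
have -> : (x == b i) = false by apply: contraNF xV => /eqP ->.
by rewrite !mul0r addr0.
Qed.

Lemma unsigned_ge0 w x : 0 <= unsigned w x.
Proof.
by apply: sumr_ge0 => i _; rewrite addr_ge0 // mulr_ge0 ?ler0n // le_max lexx.
Qed.

Lemma unsigned_sign w i :
  unsigned w (a i) != 0 -> unsigned w (b i) != 0 -> False.
Proof.
rewrite unsigned_a unsigned_b; have [h|h] := sign_cases (scoord w i).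
  by rewrite max_l // eqxx.
by rewrite (@max_l _ _ 0 (- _)) ?eqxx // oppr_le0 ltW.
Qed.

Lemma cone_point_unsigned w : cone_point e V (unsigned w).
Proof.
have suppV x : unsigned w x != 0 -> x \in V.
  by apply: contraNT => xV; rewrite unsigned_out.
split => //; first exact: unsigned_ge0.
- rewrite lt_def sumr_ge0 ?andbT => [|x _]; last exact: unsigned_ge0.
  apply/eqP => /psumr_eq0P s0; have s0' x := s0 (fun x _ => unsigned_ge0 w x) x isT.
  have /esym/eqP := scoord_sum w; rewrite big1 ?oner_eq0 // => i _.
  have := s0' (a i); have := s0' (b i); rewrite unsigned_a unsigned_b.
  have [h|h] := sign_cases (scoord w i); last first.
    by rewrite (@max_r _ _ 0 (scoord _ _)) ?ltW // => _ ->; rewrite expr0n.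
  rewrite max_r ?oppr_ge0 // => /eqP; rewrite oppr_eq0 => /eqP -> _.
  by rewrite expr0n.
- move=> x y wx wy; have [i [xi|xi]] := VP (suppV _ wx);
    have [j [yj|yj]] := VP (suppV _ wy); rewrite xi yj //.
  + have [ij|/eab' []//] := eqVneq i j; rewrite {}xi in wx.
    by rewrite {}yj -ij in wy; case: (unsigned_sign wx wy).
  + have [ij|ij] := eqVneq j i; last by have [] := eab' ij.
    by rewrite {}yj ij in wy; rewrite {}xi in wx; case: (unsigned_sign wy wx).
Qed.

Definition from_sphere (w : sphere R n) : K :=
  scale_point (cone_point_unsigned w).

Lemma cts_to_sphere : continuous to_sphere.
Proof.
have cs i : continuous (fun z : K => signed z i).
  by rewrite /signed; cts; exact: cts_bary.
apply: cts_sphere => i.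
under [X in continuous X]funext do rewrite scoord_normalize.
apply: cts_mul => //; apply: cts_inv.
  move=> z; rewrite sqrtr_eq0 -ltNge lt_def signed_neq0 /=.
  by apply: sumr_ge0 => j _; exact: sqr_ge0.
apply: (cts_comp (g := Num.sqrt)); last exact: sqrt_continuous.
apply: cts_sum => j; under [X in continuous X]funext do rewrite expr2.
by apply: cts_mul.
Qed.

Lemma cts_from_sphere : continuous from_sphere.
Proof.
apply: cts_scale => x; apply: cts_sum => i; have cw := @cts_scoord R n i.
by cts.
Qed.

Lemma to_sphereK : cancel to_sphere from_sphere.
Proof.
move=> z; set N := Num.sqrt (\sum_i signed z i ^+ 2).
have N0 : 0 < N.
  rewrite sqrtr_gt0 lt_def signed_neq0 /=.
  by apply: sumr_ge0 => j _; exact: sqr_ge0.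
have E x : unsigned (to_sphere z) x = bary z x / N.
  have [/VP[i xi]|xV] := boolP (x \in V); last first.
    by rewrite unsigned_out // bary_out // mul0r.
  have za := bary_ge0 z (a i); have zb := bary_ge0 z (b i).
  have Ni : 0 <= N^-1 by rewrite invr_ge0 ltW.
  case: xi => ->.
    rewrite unsigned_a scoord_normalize -/N /signed.
    have [->|->] := antipodal0 z i; last by rewrite subr0 max_r // divr_ge0 // ltW.
    by rewrite mul0r max_l // sub0r mulNr oppr_le0 mulr_ge0.
  rewrite unsigned_b scoord_normalize -/N /signed -mulNr opprB.
  have [->|->] := antipodal0 z i; first by rewrite subr0 max_r // divr_ge0 // ltW.
  by rewrite mul0r max_l // sub0r mulNr oppr_le0 mulr_ge0.
apply: bary_inj => x; rewrite bary_scale E (eq_bigr _ (fun x _ => E x)).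
by rewrite -mulr_suml bary_sum mul1r invrK divfK // gt_eqF.
Qed.

Lemma from_sphereK : cancel from_sphere to_sphere.
Proof.
move=> w; set S := \sum_x unsigned w x.
have S0 : 0 < S by have [] := cone_point_unsigned w.
have E i : signed (from_sphere w) i = scoord w i / S.
  rewrite /signed !bary_scale -/S -mulrBl unsigned_a unsigned_b; congr (_ / _).
  have [h|h] := sign_cases (scoord w i).
    by rewrite max_l // max_r ?oppr_ge0 // sub0r opprK.
  by rewrite max_r ?ltW // max_l ?subr0 // oppr_le0 ltW.
apply: scoord_inj => i; rewrite scoord_normalize E.
have -> : \sum_j signed (from_sphere w) j ^+ 2 = S^-1 ^+ 2.
  rewrite (eq_bigr (fun j => scoord w j ^+ 2 * S^-1 ^+ 2)).
    by rewrite -mulr_suml scoord_sum mul1r.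
  by move=> j _; rewrite E exprMn.
rewrite sqrtr_sqr gtr0_norm ?invr_gt0 // invrK divfK // gt_eqF //.
Qed.

Lemma cross_polytope_sphere : heq R K (sphere R n).
Proof.
apply: (@heq_of_cancel _ _ _ to_sphere from_sphere).
- exact: cts_to_sphere.
- exact: cts_from_sphere.
- exact: to_sphereK.
- exact: from_sphereK.
Qed.

End CrossPolytope.

Lemma spherical_point (R : realType) : spherical R (set_type [set 0 : R]).
Proof. by apply: wedge_of_spheres_spherical; exact: wedge_of_spheres_point. Qed.

Lemma spherical_sphere (R : realType) (n : nat) : spherical R (sphere R n).
Proof.
case: n => [|k].
  by apply: wedge_of_spheres_spherical; exact: wedge_of_spheres_Sm1.
have F0 : \sum_(i < k.+1) ((i == ord0)%:R : R) ^+ 2 != 0.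
  rewrite (bigD1 ord0) //= expr1n big1 ?addr0 ?oner_eq0 // => i /negPf ->.
  by rewrite expr0n.
pose p := normalize F0.
pose o : set_type [set 0 : R] := SigSub (mem_set (erefl 0 : [set 0] 0)).
exists (wedge2 o p); split.
  by apply: wedge_of_spheres_attach; exact: wedge_of_spheres_point.
apply: equivalent_rel_sym; apply: equivalent_rel_trans (wedge2_point_equiv p o).
by apply: (@heq_of_cancel _ _ _ wswap wswap);
  [exact: cts_wswap|exact: cts_wswap|exact: wswapK|exact: wswapK].
Qed.
(** * Permutation graphs *)

Section PermutationOrder.
Context {R : realType} {T : finType} (e : rel T) (alpha beta : T -> R).
Hypotheses (e_irr : forall x, ~~ e x x) (e_sym : symmetric e).
Hypothesis alpha_inj : injective alpha.
Hypothesis eE : forall x y, x != y ->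
  e x y = ((alpha x < alpha y) == (beta x < beta y)).

(** The pairs [a i], [b i] span a cross-polytope that is joined to the
    complex on [P]: [a i] is adjacent to [b i] and to nothing else among the
    pairs and [P]. *)
Definition antipodes (I : finType) (a b : I -> T) (P : {set T}) :=
  [/\ injective a, injective b, forall i j, a i != b j &
      forall i, e (a i) (b i)] /\
  [/\ forall i j, ~~ e (a i) (a j), forall i j, ~~ e (b i) (b j),
      forall i j, i != j -> ~~ e (a i) (b j) &
      forall i x, x \in P -> [/\ x != a i, x != b i, ~~ e (a i) x &
                               ~~ e (b i) x]].

Definition join_set (I : finType) (a b : I -> T) (P : {set T}) : {set T} :=
  [set x | [exists i, (x == a i) || (x == b i)] || (x \in P)]%SET.

Lemma join_setP (I : finType) (a b : I -> T) (P : {set T}) x :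
  reflect [\/ exists i, x = a i, exists i, x = b i | x \in P]
    (x \in join_set a b P).
Proof.
rewrite inE; apply: (iffP orP) => [[/existsP[i /orP[]/eqP xi]|xP]|].
- by constructor 1; exists i.
- by constructor 2; exists i.
- by constructor 3.
- move=> [[i ->]|[i ->]|xP]; [left|left|by right].
    by apply/existsP; exists i; rewrite eqxx.
  by apply/existsP; exists i; rewrite eqxx orbT.
Qed.

Lemma antipodes_sub (I : finType) (a b : I -> T) (P Q : {set T}) :
  Q \subset P -> antipodes a b P -> antipodes a b Q.
Proof.
move=> /fintype.subsetP QP [h1 [h2 h3 h4 h5]]; split => //; split => //.
by move=> i x /QP; exact: h5.
Qed.

Lemma antipodes_cons (I : finType) (a b : I -> T) (P Q : {set T}) v w :
  antipodes a b P -> v \in P -> w \in P -> e v w -> Q \subset P ->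
  (forall x, x \in Q -> [/\ x != v, x != w, ~~ e v x & ~~ e w x]) ->
  antipodes (fun o => oapp a v o) (fun o => oapp b w o) Q.
Proof.
move=> [[ai bi ab eab] [eaa ebb eab' eP]] vP wP vw /fintype.subsetP QP hQ.
have vw' : v != w by apply: contraTneq vw => ->; exact: e_irr.
split; split.
- move=> [i|] [j|] //= h; first by rewrite (ai _ _ h).
    by have [] := eP i _ vP; rewrite h eqxx.
  by have [] := eP j _ vP; rewrite -h eqxx.
- move=> [i|] [j|] //= h; first by rewrite (bi _ _ h).
    by have [_] := eP i _ wP; rewrite h eqxx.
  by have [_] := eP j _ wP; rewrite -h eqxx.
- move=> [i|] [j|] //=; first by rewrite eq_sym; have [] := eP i _ wP.
  by have [] := eP j _ vP.
- by move=> [i|] //=.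
- move=> [i|] [j|] //=; first by have [] := eP i _ vP.
  by rewrite e_sym; have [] := eP j _ vP.
- move=> [i|] [j|] //=; first by have [] := eP i _ wP.
  by rewrite e_sym; have [] := eP j _ wP.
- move=> [i|] [j|] //= h.
  + exact: eab'.
  + by have [] := eP i _ wP.
  + by rewrite e_sym; have [] := eP j _ vP.
- move=> [i|] x xQ /=; last exact: hQ.
  exact: eP (QP _ xQ).
Qed.

Lemma join_empty (I : finType) (a b : I -> T) : antipodes a b finset.set0 ->
  spherical R (ireal (R := R) e (join_set a b finset.set0)).
Proof.
move=> [[ai bi ab eab] [eaa ebb eab' _]].
pose a' (i : 'I_#|I|) := a (enum_val i); pose b' (i : 'I_#|I|) := b (enum_val i).
apply: spherical_heq (spherical_sphere R #|I|).
apply: (@cross_polytope_sphere _ _ _ _ a' b').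
- by move=> i j /ai /enum_val_inj.
- by move=> i j /bi /enum_val_inj.
- by move=> i j; exact: ab.
- by move=> i; exact: eab.
- by move=> i j; exact: eaa.
- by move=> i j; exact: ebb.
- move=> i j ij; have ij' : enum_val i != enum_val j.
    by apply: contra_neq ij => /enum_val_inj.
  by split; [|rewrite e_sym]; exact: eab'.
- move=> x; rewrite !inE orbF; apply/existsP/existsP => -[i hi].
    by exists (enum_rank i); rewrite /a' /b' enum_rankK.
  by exists (enum_val i).
Qed.

Lemma first_point (P : {set T}) x : x \in P ->
  exists2 v, v \in P & forall y, y \in P -> y != v -> alpha v < alpha y.
Proof.
move=> xP; case: (@arg_minP _ _ _ x (mem P) alpha xP) => v vP vmin.
exists v => // y yP yv; rewrite lt_def vmin // andbT.
by rewrite (inj_eq alpha_inj).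
Qed.

(** The recursion either removes [v] or [w] from [P], or moves both of them to
    the antipodal pairs while [P] shrinks to the other non-neighbours of [v]. *)
Lemma spherical_join (n : nat) (I : finType) (a b : I -> T) (P : {set T}) :
  (#|P| <= n)%N -> antipodes a b P ->
  spherical R (ireal (R := R) e (join_set a b P)).
Proof.
elim: n I a b P => [|n IH] I a b P Pn aP.
  move: Pn aP; rewrite leqn0 cards_eq0 => /eqP ->; exact: join_empty.
have [P0|[x xP]] := set_0Vmem P.
  by move: aP; rewrite P0; exact: join_empty.
have [[ai bi ab eab] [eaa ebb eab' eP]] := aP.
have [v vP vmin] := first_point xP.
have vV : v \in join_set a b P by apply/join_setP; constructor 3.
have [Pv|[x' x'P]] := set_0Vmem (P :\ v).
  have cone y : y \in join_set a b P -> ~~ e v y.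
    move=> /join_setP [[i ->]|[i ->]|yP].
    - by rewrite e_sym; have [] := eP i _ vP.
    - by rewrite e_sym; have [] := eP i _ vP.
    - suff -> : y = v by exact: e_irr.
      apply/eqP/negPn/negP => yv.
      by have := finset.in_set0 y; rewrite -Pv !inE yv yP.
  apply: spherical_heq (spherical_point R).
  apply: (cone_contractible e_irr vV cone) => y /cone.
  by rewrite e_sym.
have [w] := first_point x'P; rewrite !inE => /andP[wv wP] wmin.
have vw : alpha v < alpha w by exact: vmin.
have after y : y \in P -> y != v -> y != w -> alpha w < alpha y.
  by move=> yP yv yw; apply: wmin => //; rewrite !inE yv.
have edge y z : alpha y < alpha z -> e y z = (beta y < beta z).
  move=> yz; rewrite eE ?yz ?eqb_id //.
  by apply: contraTneq yz => ->; rewrite ltxx.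
have cardD u : u \in P -> (#|P :\ u| <= n)%N.
  by move=> uP; move: Pn; rewrite (cardsD1 u) uP.
have [evw|evw] := boolP (e v w); last first.
  have eqV : join_set a b P :\ w = join_set a b (P :\ w).
    apply/setP => y; rewrite !inE; case: eqVneq => //= ->.
    rewrite orbF; symmetry; apply/existsP => -[i].
    by have [/negPf -> /negPf ->] := eP i _ wP.
  apply: (@spherical_heq _ _ (ireal e (join_set a b P :\ w))); last first.
    rewrite eqV; apply: IH; first exact: cardD.
    by apply: antipodes_sub aP; exact: subD1set.
  apply: (@dominated_vertex _ _ e _ v w) => //.
  - by apply/join_setP; constructor 3.
  - by rewrite eq_sym.
  - move=> y /join_setP [[i ->]|[i ->]|yP] yw.
    + by have [] := eP i _ vP.
    + by have [] := eP i _ vP.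
    have [->|yv] := eqVneq y v; first exact: e_irr.
    have [->|yw'] := eqVneq y w; first by rewrite e_sym.
    have wy := after _ yP yv yw'.
    move: yw evw; rewrite e_sym (edge _ _ wy) (edge _ _ vw) -!leNgt => h1 h2.
    rewrite e_sym (edge _ _ (lt_trans vw wy)) -leNgt.
    exact: le_trans h1 h2.
(* what is left of P once v and w are an antipodal pair *)
pose N : {set T} := [set y in P | (y != v) && ~~ e v y]%SET.
have NP : N \subset P by apply/fintype.subsetP => y; rewrite inE => /andP[].
have wN y : y \in N -> [/\ y != v, y != w, ~~ e v y & ~~ e w y].
  rewrite inE => /and3P[yP yv vy].
  have yw : y != w by apply: contraNneq vy => ->.
  have wy := after _ yP yv yw.
  split => //; move: evw vy.
  rewrite (edge _ _ vw) (edge _ _ (lt_trans vw wy)) (edge _ _ wy) -!leNgt.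
  by move=> h1 h2; apply: le_trans h2 (ltW h1).
pose a' o := oapp a v o; pose b' o := oapp b w o.
have aN : antipodes a' b' N by exact: (antipodes_cons aP vP wP evw NP wN).
have Nn : (#|N| <= n)%N.
  apply: leq_trans (cardD v vP); apply: subset_leq_card.
  by apply/fintype.subsetP => y /[dup] /(fintype.subsetP NP) yP; rewrite !inE yP
    => /and3P[_ -> _].
pose V1 := join_set a b (P :\ v); pose V2 := join_set a' b' N.
have vV1 : v \notin V1.
  apply/negP => /join_setP [[i vi]|[i vi]|]; last by rewrite !inE eqxx.
    by have [] := eP i _ vP; rewrite vi eqxx.
  by have [_] := eP i _ vP; rewrite vi eqxx.
have V2_cases y : y \in V2 -> y = v \/ y \in V1.
  move=> /join_setP [[[i|] /= ->]|[[i|] /= ->]|yN].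
  - by right; apply/join_setP; constructor 1; exists i.
  - by left.
  - by right; apply/join_setP; constructor 2; exists i.
  - by right; apply/join_setP; constructor 3; rewrite !inE wv.
  - right; apply/join_setP; constructor 3.
    by have [yv _ _ _] := wN _ yN; rewrite !inE yv (fintype.subsetP NP).
have V1_cases y : y \in V1 -> y \notin V2 -> e v y.
  move=> /join_setP [[i ->]|[i ->]|].
  - by move/negP; case; apply/join_setP; constructor 1; exists (Some i).
  - by move/negP; case; apply/join_setP; constructor 2; exists (Some i).
  - rewrite !inE => /andP[yv yP]; rewrite negb_or => /andP[_].
    by rewrite yP yv /= negbK.
have -> : join_set a b P = V1 :|: V2.
  apply/setP => y; rewrite finset.in_setU; apply/join_setP/orP.
  - move=> [[i yi]|[i yi]|yP].
    + by left; apply/join_setP; constructor 1; exists i.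
    + by left; apply/join_setP; constructor 2; exists i.
    + have [->|yv] := eqVneq y v; last first.
        by left; apply/join_setP; constructor 3; rewrite !inE yv.
      by right; apply/join_setP; constructor 1; exists None.
  - have inV1 : y \in V1 -> [\/ exists i, y = a i, exists i, y = b i | y \in P].
      move=> /join_setP [h|h|]; [by constructor 1|by constructor 2|].
      by rewrite !inE => /andP[_ h]; constructor 3.
    move=> [/inV1 //|/V2_cases [->|/inV1 //]].
    by constructor 3.
have wU : w \in V1 :&: V2.
  rewrite finset.in_setI; apply/andP; split; apply/join_setP.
    by constructor 3; rewrite !inE wv.
  by constructor 2; exists None.
apply: (spherical_ireal_wedge2 e_irr e_sym wU).
- move=> y; rewrite finset.in_setI => /andP[yV1 /join_setP].
  move=> [[[i|] /= yi]|[[i|] /= yi]|/wN [] //].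
  + by rewrite yi e_sym; have [] := eP i _ wP.
  + by rewrite -yi yV1 in vV1.
  + by rewrite yi e_sym; have [] := eP i _ wP.
  + by rewrite yi; exact: e_irr.
- move=> y z yV1 yV2 zV2 zV1.
  have [->|] := V2_cases _ zV2; last by rewrite (negPf zV1).
  by rewrite e_sym; exact: V1_cases.
- apply: IH; first exact: cardD.
  by apply: antipodes_sub aP; exact: subD1set.
- exact: IH.
Qed.

Lemma spherical_independence :
  spherical R (realization R (independence_complex e)).
Proof.
have -> : independence_complex e = induced_complex e [set: T]%SET.
  by apply/setP => A; rewrite !inE finset.subsetT.
pose a (i : void) : T := of_void T i.
have -> : [set: T]%SET = join_set a a [set: T]%SET.
  by apply/setP => x; rewrite !inE orbT.
apply: (@spherical_join #|T|); first by rewrite cardsT.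
by split; split => // -[].
Qed.

End PermutationOrder.
(** * Chords of the circle *)

Section Chords.
Context {R : realType}.
Implicit Types p q r t : R.

Definition cis t : R * R := (cos t, sin t).

(** Twice the signed area of the triangle [A], [B], [C]. *)
Definition area (A B C : R * R) : R :=
  (B.1 - A.1) * (C.2 - A.2) - (B.2 - A.2) * (C.1 - A.1).

Lemma cis_periodic t : cis (t + 2 * pi) = cis t.
Proof.
by rewrite /cis mulr_natl cosD2pi sinD2pi.
Qed.

Lemma sin_triangle (u v : R) :
  sin (u + u) + sin (v + v) - sin (u + v + (u + v)) =
  4 * sin u * sin v * sin (u + v).
Proof.
have hu := cos2Dsin2 u; have hv := cos2Dsin2 v.
rewrite -[sin (u + u)]mulr1 -[X in _ * X]hv -[sin (v + v)]mulr1 -[X in _ + _ * X - _]hu.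
by rewrite !(sinD, cosD); ring.
Qed.

(** The area of an inscribed triangle is a product of sines of half the arcs
    between its vertices, all positive if the vertices are in counterclockwise
    order. *)
Lemma area_cis_gt0 p q r : p < q -> q < r -> r < p + 2 * pi ->
  0 < area (cis p) (cis q) (cis r).
Proof.
move=> pq qr rp.
pose u := (q - p) / 2; pose v := (r - q) / 2.
have u0 : 0 < u by rewrite /u; lra.
have v0 : 0 < v by rewrite /v; lra.
have uv : u + v < pi by rewrite /u /v; lra.
have qE : q = p + (u + u) by rewrite /u; lra.
have rE : r = p + (u + v + (u + v)) by rewrite /u /v; lra.
have su : 0 < sin u by apply: sin_gt0_pi; rewrite u0 /=; lra.
have sv : 0 < sin v by apply: sin_gt0_pi; rewrite v0 /=; lra.
have suv : 0 < sin (u + v) by apply: sin_gt0_pi; rewrite addr_gt0.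
suff -> : area (cis p) (cis q) (cis r) = 4 * sin u * sin v * sin (u + v).
  by rewrite !mulr_gt0.
rewrite -sin_triangle /area /cis /=.
have -> : sin (u + u) = sin q * cos p - cos q * sin p.
  by rewrite -sinB; congr sin; lra.
have -> : sin (v + v) = sin r * cos q - cos r * sin q.
  by rewrite -sinB; congr sin; lra.
have -> : sin (u + v + (u + v)) = sin r * cos p - cos r * sin p.
  by rewrite -sinB; congr sin; lra.
by ring.
Qed.

Lemma segmentC (A B : R * R) : segment A B = segment B A.
Proof.
suff sub (C D : R * R) : segment C D `<=` segment D C by apply/seteqP; split; exact: sub.
move=> _ [s + <-]; rewrite /= in_itv /= => /andP[s0 s1].
exists (1 - s); first by rewrite /= in_itv /= subr_ge0 s1 gerBl.
by rewrite opprB addrCA subrr addr0 addrC.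
Qed.

(** The four points satisfy one affine relation, whose coefficients are the
    areas of the triangles that omit one of the points.  Its signs put [A], [C]
    on one side and [B], [D] on the other, so that it exhibits a common point. *)
Lemma segments_cross (A B C D : R * R) :
  0 < area A B C -> 0 < area A B D -> 0 < area A C D -> 0 < area B C D ->
  segment A C `&` segment B D !=set0.
Proof.
move=> h1 h2 h3 h4.
have sumE : area B C D + area A B D = area A C D + area A B C.
  by rewrite /area; ring.
have n1 : area B C D + area A B D != 0 by rewrite gt_eqF // addr_gt0.
have n2 : area A C D + area A B C != 0 by rewrite gt_eqF // addr_gt0.
pose s := area A B D / (area B C D + area A B D).
pose t := area A B C / (area A C D + area A B C).
have s1 : 1 - s = area B C D / (area B C D + area A B D).
  by rewrite /s -[1](divff n1) -mulrBl addrK.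
have t1 : 1 - t = area A C D / (area A C D + area A B C).
  by rewrite /t -[1](divff n2) -mulrBl addrK.
have ratio (x y z : R) : 0 < x -> 0 < y -> 0 < z -> 0 <= x / (y + z).
  by move=> x0 y0 z0; rewrite ltW // divr_gt0 // addr_gt0.
have s01 : 0 <= s <= 1 by rewrite -(subr_ge0 s 1) s1 !ratio.
have t01 : 0 <= t <= 1 by rewrite -(subr_ge0 t 1) t1 !ratio.
exists ((1 - s) *: A + s *: C); split; first by exists s => //=; rewrite in_itv.
exists t; first by rewrite /= in_itv.
have pairE (p q : R * R) : p.1 = q.1 -> p.2 = q.2 -> p = q.
  by case: p q => ? ? [? ?] /= -> ->.
rewrite s1 t1 /s /t sumE; apply: pairE => /=.
  rewrite /GRing.scale /= !(mulrAC _ _^-1) -!mulrDl; congr (_ / _).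
  by rewrite /area; ring.
rewrite /GRing.scale /= !(mulrAC _ _^-1) -!mulrDl; congr (_ / _).
by rewrite /area; ring.
Qed.

(** [B] and [C] lie strictly on the same side of the line through [A] and
    [D]. *)
Lemma segments_nested (A B C D : R * R) :
  0 < area A B D -> 0 < area A C D -> ~ (segment A D `&` segment B C !=set0).
Proof.
move=> hB hC [Z [[s _ sZ] [t t01 tZ]]].
have onAD : area A Z D = 0.
  by rewrite -sZ /area /=; rewrite /GRing.scale /=; ring.
move: t01; rewrite /= in_itv /= => /andP[t0 t1].
have : area A Z D = (1 - t) * area A B D + t * area A C D.
  by rewrite -tZ /area /=; rewrite /GRing.scale /=; ring.
rewrite onAD => /eqP; rewrite eq_sym gt_eqF //.
have [->|tn0] := eqVneq t 0; first by rewrite subr0 mul1r mul0r addr0.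
have tp : 0 < t by rewrite lt_def tn0.
apply: ltr_wpDl; last exact: mulr_gt0.
by apply: mulr_ge0; [rewrite subr_ge0|exact: ltW].
Qed.

End Chords.
Section PermutationGraphs.
Context {R : realType} {T : finType}.

(** Cut the circle at the two division points: a chord becomes the pair of the
    angles [alpha x <= b <= beta x] of its ends on the two arcs, and two chords
    cross when their ends alternate, that is, when the two angles are ordered
    alike. *)
Lemma permutation_graph_orders (e : rel T) : permutation_graph R e ->
  [/\ forall x, ~~ e x x, symmetric e & exists alpha beta : T -> R,
    injective alpha /\ forall x y, x != y ->
      e x y = ((alpha x < alpha y) == (beta x < beta y))].
Proof.
move=> [D [[a [b [ab ba arcs]]] De]].
have angles x : exists st : R * R * bool,
    [/\ a <= st.1.1 <= b, b <= st.1.2 <= a + 2 * pi,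
      endpoint D x st.2 = cis st.1.1 & endpoint D x (~~ st.2) = cis st.1.2].
  have [s [[p pI pE] [q qI qE]]] := arcs x.
  move: pI qI; rewrite /= !in_itv /= => pI qI.
  by exists (p, q, s); split => //=; rewrite -?pE -?qE.
pose st x := projT1 (cid (angles x)).
pose alpha x := (st x).1.1; pose beta x := (st x).1.2; pose s x := (st x).2.
have stP x : [/\ a <= alpha x <= b, b <= beta x <= a + 2 * pi,
    endpoint D x (s x) = cis (alpha x) & endpoint D x (~~ s x) = cis (beta x)].
  by rewrite /alpha /beta /s /st; case: cid.
have chordE x : chord D x = segment (cis (alpha x)) (cis (beta x)).
  have [_ _ <- <-] := stP x.
  by rewrite /chord; case: (s x) => //=; rewrite segmentC.
have neq_aa x y : x <> y -> alpha x <> alpha y.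
  have [_ _ sx _] := stP x; have [_ _ sy _] := stP y.
  by move=> xy E; move: sy; rewrite -E -sx => /endpoint_inj [] /esym.
have neq_bb x y : x <> y -> beta x <> beta y.
  have [_ _ _ sx] := stP x; have [_ _ _ sy] := stP y.
  by move=> xy E; move: sy; rewrite -E -sx => /endpoint_inj [] /esym.
have neq_ab x y : cis (alpha x) <> cis (beta y).
  have [_ _ sx _] := stP x; have [_ _ _ sy] := stP y.
  rewrite -sx -sy => /endpoint_inj [-> ].
  by case: (s y).
have lt_ab x y : alpha x < beta y.
  have [/andP[_ h1] _ _ _] := stP x; have [_ /andP[h2 _] _ _] := stP y.
  rewrite lt_def (le_trans h1 h2) andbT; apply/eqP => E.
  by apply: (@neq_ab x y); rewrite E.
have lt_ba x y : beta x < alpha y + 2 * pi.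
  have [_ /andP[_ h1] _ _] := stP x; have [/andP[h2 _] _ _ _] := stP y.
  rewrite lt_def; apply/andP; split; last by move: h1 h2; lra.
  by apply/eqP => E; apply: (@neq_ab y x); rewrite -cis_periodic E.
have e_irr x : ~~ e x x by apply/negP => /De [].
have e_sym : symmetric e.
  move=> x y; apply/idP/idP => /De [xy]; rewrite setIC => h; apply/De.
    by split => // /esym.
  by split => // /esym.
split => //; exists alpha, beta; split.
  by move=> x y E; apply: contrapT => /neq_aa.
have ordered x y : alpha x < alpha y -> e x y = (beta x < beta y).
  move=> axy; have xy : x <> y by move=> E; move: axy; rewrite E ltxx.
  apply/idP/idP => [/De [_]|bxy].
    rewrite !chordE => cross; rewrite ltNge le_eqVlt negb_or.
    apply/andP; split; first by apply/eqP => /esym; exact: neq_bb.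
    apply/negP => byx; move: cross; apply: segments_nested.
      by apply: area_cis_gt0 => //; exact: lt_ab.
    by apply: area_cis_gt0 => //; exact: lt_ab.
  apply/De; split => //; rewrite !chordE; apply: segments_cross.
  - by apply: area_cis_gt0.
  - by apply: area_cis_gt0.
  - by apply: area_cis_gt0.
  - by apply: area_cis_gt0.
move=> x y /eqP xy; case: (ltgtP (alpha x) (alpha y)) => [axy|ayx|E].
- by rewrite ordered.
- rewrite e_sym ordered // ltNge le_eqVlt.
  by have /eqP/negPf -> := neq_bb _ _ xy.
- by case: (neq_aa _ _ xy).
Qed.

End PermutationGraphs.
Theorem theorem4p2 (R : realType) (T : finType) (e : rel T) :
  permutation_graph R e ->
  exists W : topologicalType,
    wedge_of_spheres R W /\
    homotopy_equivalent R (realization R (independence_complex e)) W.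
Proof.
move=> /permutation_graph_orders [e_irr e_sym [alpha [beta [alpha_inj eE]]]].
have [W [wW eW]] := spherical_independence e_irr e_sym alpha_inj eE.
exists W; split => //; exact: homotopy_equivalent_of_rel eW.
Qed.
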